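(* If there is a polynomial-time $f$-approximation algorithm for MFASP, then there is a polynomial-time $2f$-approximation algorithm for Set Cover.
   Context: All graphs are finite, undirected and simple. For a graph $G=(V,E)$ with unit edge weights and $w\in\mathbb{R}^E_{\ge 0}$, a fractional $w$-vertex cover is $y\in\mathbb{R}^V_{\ge 0}$ with $y_u+y_v\ge w_{uv}$ for all $\{u,v\}\in E$; $\nu(G,w)$ is the maximum $w$-weight of a matching, $\tau_f(G,w)$ the minimum of $\sum_v y_v$ over fractional $w$-vertex covers; $(G,w)$ is stable if $\nu(G,w)=\tau_f(G,w)$. MFASP: given $G$, find $c\in\mathbb{R}^E_{\ge0}$ with $(G,\mathbb{1}+c)$ stable minimizing $\sum_e c_e$. Set Cover: given a ground set of elements and a family of subsets, choose a minimum number of subsets whose union is the ground set. *)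

(* Defs.v *)
From Corelib Require Import BinNums.
From mathcomp Require Import all_boot all_order all_algebra reals.

Set Implicit Arguments.
Unset Strict Implicit.
Unset Printing Implicit Defensive.

Import Order.TTheory GRing.Theory Num.Theory.
Local Open Scope ring_scope.

(*  Jones' WHILE language (N. D. Jones, "Computability and Complexity from a
    Programming Perspective"): imperative programs over binary trees.  The time
    of a run charges, for every expression evaluated, the sizes of the values of
    all its subexpressions.  In particular a program cannot build in time t a
    tree larger than t plus its input, so that polynomial time in this model is
    polynomial time on Turing machines. *)

Inductive btree : Type := Leaf | Node of btree & btree.

Fixpoint btree_eqb (a b : btree) : bool :=
  match a, b with
  | Leaf, Leaf => true
  | Node a1 a2, Node b1 b2 => btree_eqb a1 b1 && btree_eqb a2 b2
  | _, _ => false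
  end.

Fixpoint tsize (a : btree) : nat :=
  if a is Node a1 a2 then (tsize a1 + tsize a2).+1 else 1%N.

(* As conditions, [Leaf] is false and every other tree is true. *)
Definition enc_bool (b : bool) : btree := if b then Node Leaf Leaf else Leaf.

Inductive expr : Type :=
  | EVar of nat
  | ENil
  | ECons of expr & expr
  | EHd of expr
  | ETl of expr
  | EEq of expr & expr.

Inductive cmd : Type :=
  | Assign of nat & expr
  | Seq of cmd & cmd
  | If of expr & cmd & cmd
  | While of expr & cmd.

Definition store := nat -> btree.

Definition update (s : store) (x : nat) (v : btree) : store :=
  fun y => if y == x then v else s y.

Fixpoint eval (e : expr) (s : store) : btree :=
  match e with
  | EVar x => s x
  | ENil => Leaf
  | ECons e1 e2 => Node (eval e1 s) (eval e2 s)
  | EHd e1 => if eval e1 s is Node a _ then a else Leaf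
  | ETl e1 => if eval e1 s is Node _ a then a else Leaf
  | EEq e1 e2 => enc_bool (btree_eqb (eval e1 s) (eval e2 s))
  end.

Fixpoint ecost (e : expr) (s : store) : nat :=
  (tsize (eval e s) +
   match e with
   | EVar _ | ENil => 0
   | ECons e1 e2 | EEq e1 e2 => ecost e1 s + ecost e2 s
   | EHd e1 | ETl e1 => ecost e1 s
   end)%N.

(* [exec c s t s']: started in store s, the command c halts in store s' after
   time t. *)
Inductive exec : cmd -> store -> nat -> store -> Prop :=
  | exec_assign x e s :
      exec (Assign x e) s (ecost e s) (update s x (eval e s))
  | exec_seq c1 c2 s t1 s1 t2 s2 :
      exec c1 s t1 s1 -> exec c2 s1 t2 s2 ->
      exec (Seq c1 c2) s (t1 + t2)%N s2
  | exec_if_true e c1 c2 s t s1 :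
      eval e s <> Leaf -> exec c1 s t s1 ->
      exec (If e c1 c2) s (ecost e s + t)%N s1
  | exec_if_false e c1 c2 s t s1 :
      eval e s = Leaf -> exec c2 s t s1 ->
      exec (If e c1 c2) s (ecost e s + t)%N s1
  | exec_while_true e c s t1 s1 t2 s2 :
      eval e s <> Leaf -> exec c s t1 s1 -> exec (While e c) s1 t2 s2 ->
      exec (While e c) s (ecost e s + t1 + t2)%N s2
  | exec_while_false e c s :
      eval e s = Leaf -> exec (While e c) s (ecost e s) s.

(* Input and output are in variable 0; the other variables start as [Leaf]. *)
Definition runs (c : cmd) (input : btree) (t : nat) (output : btree) : Prop :=
  exists s : store,
    exec c (update (fun=> Leaf) 0%N input) t s /\ s 0%N = output.

Definition enc_seq (T : Type) (enc : T -> btree) (s : seq T) : btree :=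
  foldr (fun x a => Node (enc x) a) Leaf s.

(* Least significant bit first. *)
Fixpoint bits_of_pos (p : positive) : seq bool :=
  match p with
  | xH => [:: true]
  | xO p => false :: bits_of_pos p
  | xI p => true :: bits_of_pos p
  end.

Definition bits_of_nat (n : nat) : seq bool :=
  if bin_of_nat n is Npos p then bits_of_pos p else [::].

Definition enc_nat (n : nat) : btree := enc_seq enc_bool (bits_of_nat n).

Definition enc_int (z : int) : btree :=
  Node (enc_bool (z < 0)) (enc_nat `|z|%N).

Definition enc_rat (q : rat) : btree :=
  Node (enc_int (numq q)) (enc_int (denq q)).

Definition enc_vector (T : Type) (enc : T -> btree) (n : nat)
    (v : 'I_n -> T) : btree :=
  enc_seq enc [seq v i | i <- enum 'I_n].

Definition enc_matrix (T : Type) (enc : T -> btree) (m n : nat)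
    (a : 'I_m -> 'I_n -> T) : btree :=
  enc_vector (fun i => enc_vector enc (a i)) id.

(* [writes t s]: the tree t is a representation of the solution s.  Solutions
   may be real-valued, in which case only some of them have representations. *)
Record min_problem (R : realType) := MinProblem {
  instance : Type;
  encode : instance -> btree;
  solution : instance -> Type;
  writes : forall x : instance, btree -> solution x -> Prop;
  feasible : forall x : instance, solution x -> Prop;
  cost : forall x : instance, solution x -> R
}.

(* The output is compared with all feasible solutions, representable or not.
   An instance without feasible solution only constrains the running time. *)
Definition approximates (R : realType) (Q : min_problem R) (f : R)
    (x : instance Q) (output : btree) : Prop :=
  (exists s : solution x, feasible s) ->
  exists s : solution x,
    [/\ writes output s, feasible s
      & forall s' : solution x, feasible s' -> cost s <= f * cost s'].

Definition polytime_approximable (R : realType) (Q : min_problem R) (f : R)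
    : Prop :=
  exists (c : cmd) (p : {poly nat}), forall x : instance Q,
    exists (t : nat) (output : btree),
      [/\ runs c (encode x) t output,
          (t <= p.[tsize (encode x)])%N
        & approximates f x output].

Record sgraph := SGraph {
  nvertices : nat;
  adj : rel 'I_nvertices;
  adj_sym : symmetric adj;
  adj_irr : irreflexive adj
}.

Section Stability.

Variables (R : realType) (G : sgraph).
Let V := 'I_(nvertices G).

Definition edges : {set {set V}} :=
  [set [set uv.1; uv.2] | uv in [pred uv : V * V | adj uv.1 uv.2]].

Definition matching (M : {set {set V}}) : bool :=
  (M \subset edges) && trivIset M.

(* The default value 0 is the weight of the empty matching. *)
Definition nu (w : {set V} -> R) : R :=
  \big[Num.max/0]_(M : {set {set V}} | matching M) \sum_(e in M) w e.

Definition fractional_vertex_cover (w : {set V} -> R) (y : V -> R) : Prop :=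
  (forall v, 0 <= y v) /\
  (forall u v, adj u v -> w [set u; v] <= y u + y v).

Definition is_tau_f (w : {set V} -> R) (t : R) : Prop :=
  (exists y, fractional_vertex_cover w y /\ \sum_v y v = t) /\
  (forall y, fractional_vertex_cover w y -> t <= \sum_v y v).

Definition stable (w : {set V} -> R) : Prop := is_tau_f w (nu w).

Definition additive_stabilizer (c : {set V} -> R) : Prop :=
  (forall e, e \in edges -> 0 <= c e) /\ stable (fun e => 1 + c e).

End Stability.

(* A graph is given by its adjacency matrix.  A solution is written as the
   matrix of the rationals c {u, v}, whose entries outside the edges are
   irrelevant. *)
Definition MFASP (R : realType) : min_problem R := {|
  instance := sgraph;
  encode := fun G => enc_matrix enc_bool (@adj G);
  solution := fun G => {set 'I_(nvertices G)} -> R;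
  writes := fun G t c =>
    exists q : {set 'I_(nvertices G)} -> rat,
      (forall e, c e = ratr (q e)) /\
      t = enc_matrix enc_rat (fun u v => q [set u; v]);
  feasible := fun G c => additive_stabilizer c;
  cost := fun G c => \sum_(e in edges G) c e
|}.

Record set_system := SetSystem {
  n_elements : nat;
  n_sets : nat;
  member : 'I_n_sets -> {set 'I_n_elements}
}.

(* The number of elements (in unary) and the incidence matrix; a solution is
   written as the characteristic vector of the chosen indices. *)
Definition SetCover (R : realType) : min_problem R := {|
  instance := set_system;
  encode := fun X =>
    Node (enc_seq (fun=> Leaf) (enum 'I_(n_elements X)))
         (enc_matrix enc_bool (fun i e => e \in @member X i));
  solution := fun X => {set 'I_(n_sets X)};
  writes := fun X t I => t = enc_vector enc_bool (fun i => i \in I);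
  feasible := fun X I => \bigcup_(i in I) member i = setT;
  cost := fun X I => #|I|%:R
|}.

(* Main.v *)
Require Import Defs.
From HB Require Import structures.
From mathcomp Require Import all_boot all_order all_algebra reals.
From mathcomp Require Import zify lra.

Set Implicit Arguments.
Unset Strict Implicit.
Unset Printing Implicit Defensive.

(* [Defs.tsize] would otherwise be hidden by [tuple.tsize]. *)
Import Defs.
Import Order.TTheory GRing.Theory Num.Theory.

(* By complementary slackness, (G, 1 + c) is stable iff there are a fractional
   vertex cover y and a matching with 1 + c_uv = y_u + y_v on the matching edges
   and y = 0 on the exposed vertices.

   Given m elements and n sets, take for every set N = 6mn + 1 copies of a huge
   even clique with one distinguished vertex, and for every element j an odd
   clique with two vertices for every set i and a root; the two vertices for a
   set i containing j are joined to the distinguished vertices of the copies of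
   i, and all other vertices of the clique of j to those of all copies of all
   sets.  The clique of j cannot be perfectly matched inside itself, and matching
   it to a copy of a set breaks a huge clique.  So one of its vertices is exposed;
   it has y = 0, which forces y >= 1 on the distinguished vertices of all copies
   of some set containing j.  In each copy this costs 1/2 at the optimum, and in
   any stabilizer it costs at least 1/3 on a single edge unless the
   whole clique becomes expensive.  A cover I gives a stabilizer of cost mn + |I|N/2.
   Conversely, the sets all of whose copies carry an edge of value at least 1/3
   number at most 3/N times the cost; if they do not cover, then the cost is so
   large that all sets may be returned.  The factor is
   (3/N) (mn + |I|N/2) <= 2 |I|, as mn <= |I|N/6. *)


(** * Polynomial-time functions on trees *)

(** The base [n + 2] is at least 2 even at [n = 0], so constants and sums are absorbed by a larger
    exponent and one number [k] describes the bound. *)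
Definition polyb (f : nat -> nat) := exists k, forall n, f n <= (n + 2) ^ k.

Lemma leq_expl m n k : m <= n -> m ^ k <= n ^ k.
Proof. by case: k => // k mn; rewrite leq_exp2r. Qed.

Lemma polyb_le f g : (forall n, f n <= g n) -> polyb g -> polyb f.
Proof. by move=> fg [k gk]; exists k => n; apply: leq_trans (fg n) (gk n). Qed.

Lemma polyb_id : polyb id.
Proof. by exists 1 => n; rewrite expn1 leq_addr. Qed.

Lemma polyb_const c : polyb (fun=> c).
Proof.
exists c => n; apply: leq_trans (ltnW (ltn_expl c (isT : 1 < 2))) _.
by rewrite leq_expl // leq_addl.
Qed.

Lemma polyb_mul f g : polyb f -> polyb g -> polyb (fun n => f n * g n).
Proof. by move=> [k fk] [l gl]; exists (k + l) => n; rewrite expnD leq_mul. Qed.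

Lemma polyb_add f g : polyb f -> polyb g -> polyb (fun n => f n + g n).
Proof.
move=> [k fk] [l gl]; exists (k + l).+1 => n.
have le1 e e' : (n + 2) ^ e <= (n + 2) ^ (e + e').
  by rewrite leq_pexp2l ?addn2 // leq_addr.
have := leq_trans (fk n) (le1 k l); have := leq_trans (gl n) (le1 l k).
rewrite [l + k]addnC expnS; nia.
Qed.

Lemma polyb_exp f k : polyb f -> polyb (fun n => f n ^ k).
Proof. by move=> [l fl]; exists (l * k) => n; rewrite expnM leq_expl. Qed.

Lemma polyb_expb f k : polyb f -> polyb (fun n => (f n + 2) ^ k).
Proof. by move=> fl; apply/polyb_exp/polyb_add => //; apply: polyb_const. Qed.

Ltac polyb := solve [repeat first [apply: polyb_id | apply: polyb_const
  | assumption | apply: polyb_add | apply: polyb_mul | apply: polyb_expb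
  | apply: polyb_exp]].

Lemma polyb_horner (p : {poly nat}) : polyb (fun n => p.[n]%R).
Proof.
elim/poly_ind: p => [|p c [k IH]].
  by apply: polyb_le (polyb_const 0) => n; rewrite horner0.
apply: (@polyb_le _ (fun n => (n + 2) ^ k * n + c)); last by polyb.
by move=> n; rewrite hornerMXaddC; apply: leq_add => //; apply: leq_mul.
Qed.

Lemma polyb_poly f : polyb f -> exists p : {poly nat}, forall n, f n <= p.[n]%R.
Proof.
move=> [k fk]; exists (('X + 2%:P) ^+ k)%R => n.
apply: leq_trans (fk n) _.
by rewrite horner_exp hornerD hornerX hornerC -natrXE.
Qed.

(** * Programs computing functions on trees, and their composition *)

Definition hd (a : btree) : btree := if a is Node a1 _ then a1 else Leaf.
Definition tl (a : btree) : btree := if a is Node _ a2 then a2 else Leaf.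

Lemma tsize_gt0 a : 0 < tsize a. Proof. by case: a. Qed.

Lemma tsize_hd a : tsize (hd a) <= tsize a.
Proof. by case: a => //= a b; apply: leq_trans (leq_addr _ _) (leqnSn _). Qed.

Lemma tsize_tl a : tsize (tl a) <= tsize a.
Proof. by case: a => //= a b; apply: leq_trans (leq_addl _ _) (leqnSn _). Qed.

Lemma tsize_enc_bool b : tsize (enc_bool b) <= 3. Proof. by case: b. Qed.

Lemma btree_eqbP : Equality.axiom btree_eqb.
Proof.
elim=> [|a1 IH1 a2 IH2] [|b1 b2] /=; try by constructor.
by apply: (iffP andP) => [[/IH1-> /IH2->]|[<- <-]] //; split; [apply/IH1|apply/IH2].
Qed.

HB.instance Definition _ := hasDecEq.Build btree btree_eqbP.

Lemma eval_ecost e s : tsize (eval e s) <= ecost e s.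
Proof. by case: e => *; apply: leq_addr. Qed.

Lemma updateE s x v y : update s x v y = if y == x then v else s y.
Proof. by []. Qed.

Lemma update_eq s x v : update s x v x = v. Proof. by rewrite /update eqxx. Qed.

(** An assignment is charged at least the size of the value it stores, so growth is paid for by
    time. *)
Lemma exec_tsize c s t s' : exec c s t s' ->
  forall y, tsize (s' y) <= tsize (s y) + t.
Proof.
elim=> {c s t s'}.
- move=> x e s y; rewrite updateE; case: eqP => _; last exact: leq_addr.
  by apply: leq_trans (eval_ecost e s) (leq_addl _ _).
- by move=> c1 c2 s t1 s1 t2 s2 _ IH1 _ IH2 y; have := IH1 y; have := IH2 y; lia.
- by move=> e c1 c2 s t s1 _ _ IH y; have := IH y; lia.
- by move=> e c1 c2 s t s1 _ _ IH y; have := IH y; lia.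
- move=> e c s t1 s1 t2 s2 _ _ IH1 _ IH2 y.
  by have := IH1 y; have := IH2 y; lia.
- by move=> e c s _ y; apply: leq_addr.
Qed.

(* The variables from 1 to b - 1 are temporaries; the program must leave them
   as it found them, so that programs can be composed. *)
Definition ptime_on (D : btree -> Prop) (g : btree -> btree) :=
  exists c b k, forall s : store,
  D (s 0) -> (forall y, 0 < y < b -> s y = Leaf) -> exists t s',
  [/\ exec c s t s', s' 0 = g (s 0), (forall y, 0 < y -> s' y = s y)
    & t <= (tsize (s 0) + 2) ^ k].

Definition ptime (g : btree -> btree) := exists c b k, forall s : store,
  (forall y, 0 < y < b -> s y = Leaf) -> exists t s',
  [/\ exec c s t s', s' 0 = g (s 0), (forall y, 0 < y -> s' y = s y)
    & t <= (tsize (s 0) + 2) ^ k].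

Lemma eq_ptime g g' : g =1 g' -> ptime g -> ptime g'.
Proof.
move=> gg' [c [b [k H]]]; exists c, b, k => s /H[t [s' []]].
by rewrite gg'; exists t, s'.
Qed.

(** Needed for composition: the time of a second program is polynomial in the size of the
    intermediate value, which must in turn be polynomial in the input. *)
Lemma ptime_tsize g : ptime g ->
  exists k, forall x, tsize (g x) <= (tsize x + 2) ^ k.
Proof.
move=> [c [b [k H]]].
have [k' k'P] : polyb (fun n => n + (n + 2) ^ k) by polyb.
exists k' => x; apply: leq_trans (k'P _).
have [|t [s' [E <- _ tk]]] := H (update (fun=> Leaf) 0 x).
  by move=> [|y].
apply: leq_trans (exec_tsize E 0) _.
by rewrite update_eq in tk *; rewrite leq_add2l.
Qed.

Lemma ptime_expr g e f : (forall s, eval e s = g (s 0)) ->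
  (forall s, ecost e s <= f (tsize (s 0))) -> polyb f -> ptime g.
Proof.
move=> eg ek [k fk]; exists (Assign 0 e), 0, k => s _.
exists (ecost e s), (update s 0 (eval e s)); split.
- exact: exec_assign.
- by rewrite update_eq eg.
- by case.
- exact: leq_trans (ek s) _.
Qed.

Lemma ptime_id : ptime (fun x => x).
Proof.
by apply: (@ptime_expr _ (EVar 0) (fun n => n + 0)) => //; polyb.
Qed.

Lemma ptime_Leaf : ptime (fun=> Leaf).
Proof. by apply: (@ptime_expr _ ENil (fun=> 1)) => //; polyb. Qed.

Lemma ptime_hd0 : ptime hd.
Proof.
apply: (@ptime_expr _ (EHd (EVar 0)) (fun n => n + n)) => //; last by polyb.
by move=> s; rewrite /= addn0; have := tsize_hd (s 0); case: (s 0) => /= *; lia.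
Qed.

Lemma ptime_tl0 : ptime tl.
Proof.
apply: (@ptime_expr _ (ETl (EVar 0)) (fun n => n + n)) => //; last by polyb.
by move=> s; rewrite /= addn0; have := tsize_tl (s 0); case: (s 0) => /= *; lia.
Qed.

Lemma ptime_eq0 : ptime (fun x => enc_bool (hd x == tl x)).
Proof.
apply: (@ptime_expr _ (EEq (EHd (EVar 0)) (ETl (EVar 0))) (fun n => n * 4 + 3)).
- by [].
- move=> s /=; rewrite !addn0; set e := enc_bool _.
  have : tsize e <= 3 by apply: tsize_enc_bool.
  have := tsize_hd (s 0); have := tsize_tl (s 0); rewrite /hd /tl.
  case: (s 0) => /= *; lia.
- by polyb.
Qed.

(** The domain [D] serves loops whose size bound is known only for inputs of a certain shape; it
    disappears once the preceding function produces only such inputs. *)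
Lemma ptime_on_comp D g f : ptime_on D g -> ptime f -> (forall x, D (f x)) ->
  ptime (fun x => g (f x)).
Proof.
move=> [cg [bg [kg Hg]]] pf Df; have [l fl] := ptime_tsize pf.
case: pf => [cf [bf [kf Hf]]].
have [k kP] : polyb (fun n => (n + 2) ^ kf + ((n + 2) ^ l + 2) ^ kg) by polyb.
exists (Defs.Seq cf cg), (maxn bf bg), k => s sL.
have [y yb|t1 [s1 [E1 s10 s1y t1k]]] := Hf s.
  by apply: sL; rewrite leq_max; case/andP: yb => -> ->.
have [|y yb|t2 [s2 [E2 s20 s2y t2k]]] := Hg s1.
- by rewrite s10.
- by rewrite s1y; [apply: sL; rewrite leq_max|]; case/andP: yb => -> // ->; rewrite orbT.
exists (t1 + t2), s2; split.
- exact: exec_seq E1 E2.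
- by rewrite s20 s10.
- by move=> y y0; rewrite s2y // s1y.
- apply: leq_trans (kP _); apply: leq_add => //.
  by apply: leq_trans t2k _; rewrite leq_expl // s10 leq_add2r.
Qed.

Lemma ptime_comp g f : ptime g -> ptime f -> ptime (fun x => g (f x)).
Proof.
move=> [c [b [k H]]] pf; apply: (@ptime_on_comp (fun=> True)) pf _ => //.
by exists c, b, k => s _; apply: H.
Qed.

Lemma ptime_hd f : ptime f -> ptime (fun x => hd (f x)).
Proof. exact: ptime_comp ptime_hd0. Qed.

Lemma ptime_tl f : ptime f -> ptime (fun x => tl (f x)).
Proof. exact: ptime_comp ptime_tl0. Qed.

(** The input is saved in [b] and the value of [f] in [b.+1], both beyond the temporaries of the two
    programs. Both are cleared at the end, which restores the invariant on temporaries. *)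
Lemma ptime_Node f g : ptime f -> ptime g -> ptime (fun x => Node (f x) (g x)).
Proof.
move=> pf pg.
have [lf flf] := ptime_tsize pf; have [lg glg] := ptime_tsize pg.
case: pf pg => [cf [bf [kf Hf]]] [cg [bg [kg Hg]]].
pose b := (maxn bf bg).+1.
(* The summands bound the costs of the eight commands below, in their order. *)
have [k kP] : polyb (fun n => n + ((n + 2) ^ kf + ((n + 2) ^ lf + (n +
   ((n + 2) ^ kg + ((1 + (n + 2) ^ lf * 2 + (n + 2) ^ lg * 2) + (1 + 1)))))))
  by polyb.
exists (Defs.Seq (Assign b (EVar 0)) (Defs.Seq cf
  (Defs.Seq (Assign b.+1 (EVar 0)) (Defs.Seq (Assign 0 (EVar b)) (Defs.Seq cg
  (Defs.Seq (Assign 0 (ECons (EVar b.+1) (EVar 0)))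
  (Defs.Seq (Assign b ENil) (Assign b.+1 ENil)))))))), b.+2, k => s sL.
pose s1 := update s b (s 0).
have s1L y : y < b -> s1 y = s y by rewrite /s1 updateE => yb; rewrite ltn_eqF.
have [y /andP[y0 yb]|t2 [s2 [E2 s20 s2y t2k]]] := Hf s1.
  have yb' : y < b by rewrite ltnS; apply: leq_trans (ltnW yb) (leq_maxl _ _).
  by rewrite s1L // sL // y0; lia.
pose s3 := update s2 b.+1 (s2 0); pose s4 := update s3 0 (s3 b).
have s3b : s3 b = s 0.
  by rewrite /s3 updateE ltn_eqF // s2y // /s1 update_eq.
have s40 : s4 0 = s 0 by rewrite /s4 update_eq.
have s4y y : 0 < y < b -> s4 y = s y.
  move=> /andP[y0 yb]; rewrite /s4 /s3 !updateE gtn_eqF // ltn_eqF ?s2y ?s1L //.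
  exact: ltnW.
have s10 : s1 0 = s 0 by rewrite s1L.
have [y /andP[y0 yb]|t5 [s5 [E5 s50 s5y t5k]]] := Hg s4.
  have yb' : y < b by rewrite ltnS; apply: leq_trans (ltnW yb) (leq_maxr _ _).
  by rewrite s4y ?y0 // sL // y0; lia.
pose s6 := update s5 0 (Node (s5 b.+1) (s5 0)).
pose s7 := update s6 b Leaf; pose s8 := update s7 b.+1 Leaf.
have s5b1 : s5 b.+1 = f (s 0).
  by rewrite s5y // /s4 updateE /= /s3 update_eq s20 s10.
eexists; exists s8; split.
- apply: exec_seq (exec_assign _ _ _) _; rewrite -/s1.
  apply: exec_seq E2 _; apply: exec_seq (exec_assign _ _ _) _; rewrite -/s3.
  apply: exec_seq (exec_assign _ _ _) _; rewrite -/s4.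
  apply: exec_seq E5 _; apply: exec_seq (exec_assign _ _ _) _; rewrite -/s6.
  apply: exec_seq (exec_assign _ _ _) (exec_assign _ _ _).
- by rewrite /s8 /s7 /s6 !updateE /= s5b1 s50 s40.
- move=> y y0; rewrite /s8 /s7 /s6 !updateE.
  case: eqP => [->|/eqP ny]; first by rewrite sL //; lia.
  case: eqP => [->|/eqP ny']; first by rewrite sL //; lia.
  rewrite gtn_eqF // s5y // /s4 updateE gtn_eqF // /s3 updateE (negPf ny).
  by rewrite s2y // /s1 updateE (negPf ny').
- apply: leq_trans (kP _); rewrite s10 s40 in t2k t5k.
  rewrite /= s5b1 s50 s20 s40 s10 s3b.
  have := flf (s 0); have := glg (s 0); lia.
Qed.

(** The flag is moved to the fresh variable [b]. When the test fails [b] already holds [Leaf], so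
    only the other branch has to clear it. *)
Lemma ptime_branch g h : ptime g -> ptime h ->
  ptime (fun x => if hd x is Node _ _ then g (tl x) else h (tl x)).
Proof.
move=> [cg [bg [kg Hg]]] [ch [bh [kh Hh]]].
pose b := (maxn bg bh).+1.
have [k kP] : polyb (fun n => (n + n) + ((n + n) +
  (n + (3 + ((n + 2) ^ kg + (n + 2) ^ kh))))) by polyb.
exists (Defs.Seq (Assign b (EHd (EVar 0))) (Defs.Seq (Assign 0 (ETl (EVar 0)))
  (If (EVar b) (Defs.Seq (Assign b ENil) cg) ch))), b.+1, k => s sL.
pose s1 := update s b (hd (s 0)); pose s2 := update s1 0 (tl (s1 0)).
have s10 : s1 0 = s 0 by [].
have s20 : s2 0 = tl (s 0) by [].
have s2b : s2 b = hd (s 0) by rewrite /s2 updateE /= /s1 update_eq.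
pose s3 := update s2 b Leaf.
have s3y y : 0 < y -> s3 y = s y.
  move=> y0; rewrite /s3 /s2 /s1 !updateE; case: eqP => [->|_]; last by rewrite gtn_eqF.
  by rewrite sL // /b; lia.
have sz := tsize_hd (s 0); have sz' := tsize_tl (s 0).
have c1 : ecost (EHd (EVar 0)) s <= tsize (s 0) + tsize (s 0).
  by rewrite /= addn0 leq_add2r.
have c2 : ecost (ETl (EVar 0)) s1 <= tsize (s 0) + tsize (s 0).
  by rewrite /= addn0 s10 leq_add2r.
have c3 : ecost (EVar b) s2 <= tsize (s 0) by rewrite /= addn0 s2b.
case Eh: (hd (s 0)) => [|a1 a2].
  have [y /andP[y0 yb]|t4 [s4 [E4 s40 s4y t4k]]] := Hh s2.
    have yb' : y < b by rewrite /b; lia.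
    by rewrite /s2 /s1 !updateE gtn_eqF // ltn_eqF // sL // y0 ltnW.
  eexists; exists s4; split.
  - apply: exec_seq (exec_assign _ _ _) _; rewrite -/(hd (s 0)) -/s1.
    apply: exec_seq (exec_assign _ _ _) _; rewrite -/(tl (s1 0)) -/s2.
    by apply: exec_if_false E4; rewrite /= s2b.
  - by rewrite s40.
  - move=> y y0; rewrite s4y // -s3y // /s3 updateE; case: eqP => // ->.
    by rewrite s2b.
  - apply: leq_trans (kP _); apply: leq_add => //; apply: leq_add => //.
    apply: leq_add => //; apply: leq_trans t4k _; rewrite s20.
    by do 2![apply: leq_trans (leq_addl _ _)]; rewrite leq_expl // leq_add2r.
have [y /andP[y0 yb]|t4 [s4 [E4 s40 s4y t4k]]] := Hg s3.
  by rewrite s3y // sL // y0 /b; lia.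
eexists; exists s4; split.
- apply: exec_seq (exec_assign _ _ _) _; rewrite -/(hd (s 0)) -/s1.
  apply: exec_seq (exec_assign _ _ _) _; rewrite -/(tl (s1 0)) -/s2.
  apply: exec_if_true; first by rewrite /= s2b Eh.
  by apply: exec_seq (exec_assign _ _ _) _; exact: E4.
- by rewrite s40.
- by move=> y y0; rewrite s4y // s3y.
- apply: leq_trans (kP _); apply: leq_add => //; apply: leq_add => //.
  apply: leq_add => //; apply: leq_add => //; apply: leq_trans t4k _.
  by apply: leq_trans (leq_addr _ _); rewrite leq_expl // leq_add2r.
Qed.

(** * Trees read as lists along the right spine, and loops over lists *)

Fixpoint lst (a : btree) : seq btree := if a is Node e r then e :: lst r else [::].
Definition tree : seq btree -> btree := foldr Node Leaf.

Lemma treeK : cancel tree lst. Proof. by elim=> //= e r ->. Qed.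
Lemma lstK : cancel lst tree. Proof. by elim=> //= e _ r ->. Qed.

Lemma size_lst a : size (lst a) < tsize a.
Proof. by elim: a => //= e _ r IH; have := tsize_gt0 e; lia. Qed.

(** Variable [v] holds the rest of the list and variable 0 the accumulator. [A] bounds every
    intermediate accumulator, and [V] stays fixed while the list shrinks, so each round has the same
    cost bound. *)
Lemma exec_foldl h ch bh kh v A (s : store) :
  (forall s : store, (forall y, 0 < y < bh -> s y = Leaf) -> exists t s',
    [/\ exec ch s t s', s' 0 = h (s 0), (forall y, 0 < y -> s' y = s y)
      & t <= (tsize (s 0) + 2) ^ kh]) ->
  0 < v -> bh <= v -> (forall y, 0 < y < v -> s y = Leaf) ->
  (forall i, tsize (foldl (fun a e => h (Node e a)) (s 0) (take i (lst (s v)))) <= A) ->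
  forall V, tsize (s v) <= V ->
  exists t s', [/\ exec (While (EVar v)
    (Defs.Seq (Assign 0 (ECons (EHd (EVar v)) (EVar 0)))
      (Defs.Seq ch (Assign v (ETl (EVar v)))))) s t s',
    s' 0 = foldl (fun a e => h (Node e a)) (s 0) (lst (s v)),
    (forall y, 0 < y -> s' y = if y == v then Leaf else s y)
    & t <= size (lst (s v)) * ((V + A + 3) ^ kh + (V * 6 + A * 2 + 1)) + 1].
Proof.
move=> Hh v0 bv; move Ea: (s v) => a; elim: a s Ea => [|e _ r IH] s sv sL sA V Vv.
  exists (tsize (s v) + 0), s; split=> //; last by rewrite sv.
    by apply: exec_while_false.
  by move=> y _; case: eqP => // ->.
pose s1 := update s 0 (Node e (s 0)).
have [y /andP[y0 yb]|t2 [s2 [E2 s20 s2y t2k]]] := Hh s1.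
  by rewrite /s1 updateE gtn_eqF // sL // y0; apply: leq_trans bv.
have s1v : s1 v = Node e r by rewrite /s1 updateE gtn_eqF.
pose s3 := update s2 v r.
have s30 : s3 0 = h (Node e (s 0)) by rewrite /s3 updateE ltn_eqF // s20.
have s3v : s3 v = r by rewrite /s3 update_eq.
have [|||t4 [s4 [E4 s40 s4y t4k]]] := IH s3 s3v _ _ V.
- move=> y /andP[y0 yv]; rewrite /s3 updateE ltn_eqF // s2y // /s1 updateE gtn_eqF //.
  by rewrite sL // y0.
- by move=> i; rewrite s30; apply: (sA i.+1).
- by apply: leq_trans Vv => /=; rewrite ltnW // ltnS leq_addl.
eexists; exists s4; split.
- apply: exec_while_true; [by rewrite /= sv| |exact: E4].
  apply: exec_seq (exec_assign _ _ _) _.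
  have -> : update s 0 (eval (ECons (EHd (EVar v)) (EVar 0)) s) = s1.
    by rewrite /s1 /= sv.
  apply: exec_seq E2 _.
  have -> : s3 = update s2 v (eval (ETl (EVar v)) s2) by rewrite /= s2y // s1v.
  exact: exec_assign.
- by rewrite s40 s30.
- move=> y y0; rewrite s4y // /s3 updateE; case: eqP => // _.
  by rewrite s2y // /s1 updateE gtn_eqF.
- rewrite [size _]/= mulSn -[leqRHS]addnA; apply: leq_add => [|//]; rewrite /= sv s2y // s1v.
  have t2V : t2 <= (V + A + 3) ^ kh.
    apply: leq_trans t2k _; rewrite leq_expl // /s1 update_eq /=.
    by have := sA 0; rewrite take0 /=; move: Vv => /=; lia.
  rewrite /= in Vv; have := sA 0; rewrite take0 /=; lia.
Qed.

(** Iterating a polynomial-time step can produce values of exponential size, hence the separate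
    hypothesis bounding all intermediate accumulators. *)
Lemma ptime_iter D h f : ptime h -> polyb f ->
  (forall x i, D x -> tsize (foldl (fun a e => h (Node e a)) (tl x) (take i (lst (hd x))))
     <= f (tsize x)) ->
  ptime_on D (fun x => foldl (fun a e => h (Node e a)) (tl x) (lst (hd x))).
Proof.
move=> [ch [bh [kh Hh]]] pf fA; pose b := bh.+1.
have [k kP] : polyb (fun n => (n + n) + ((n + n) +
   (n * ((n + f n + 1 + 2) ^ kh + (n * 6 + f n * 2 + 1)) + 1))) by polyb.
exists (Defs.Seq (Assign b (EHd (EVar 0))) (Defs.Seq (Assign 0 (ETl (EVar 0)))
  (While (EVar b) (Defs.Seq (Assign 0 (ECons (EHd (EVar b)) (EVar 0)))
      (Defs.Seq ch (Assign b (ETl (EVar b)))))))), b.+1, k => s Ds sL.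
pose s1 := update s b (hd (s 0)); pose s2 := update s1 0 (tl (s 0)).
have s2b : s2 b = hd (s 0) by rewrite /s2 updateE /= /s1 update_eq.
have s20 : s2 0 = tl (s 0) by [].
have [|||||t3 [s3 [E3 s30 s3y t3k]]] :=
    @exec_foldl h ch bh kh b (f (tsize (s 0))) s2 Hh _ _ _ _ (tsize (s 0)).
- by [].
- exact: leqnSn.
- move=> y /andP[y0 yb]; rewrite /s2 /s1 !updateE gtn_eqF // ltn_eqF //.
  by rewrite sL // y0; lia.
- by move=> i; rewrite s2b s20; apply: fA.
- by rewrite s2b; apply: tsize_hd.
eexists; exists s3; split.
- apply: exec_seq (exec_assign _ _ _) _; rewrite -/(hd (s 0)) -/s1.
  by apply: exec_seq (exec_assign _ _ _) _; exact: E3.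
- by rewrite s30 s20 s2b.
- move=> y y0; rewrite s3y //; case: eqP => [->|ny]; first by rewrite sL // /b; lia.
  by rewrite /s2 /s1 !updateE gtn_eqF //; case: eqP ny.
- apply: leq_trans (kP _); apply: leq_add.
    by rewrite /= addn0 leq_add2r tsize_hd.
  apply: leq_add; first by rewrite /= addn0 leq_add2r tsize_tl.
  apply: leq_trans t3k _; rewrite leq_add2r -[_ + 1 + 2]addnA; apply: leq_mul => //.
  by rewrite s2b; apply: leq_trans (ltnW (size_lst _)) (tsize_hd _).
Qed.

Lemma ptime_const a : ptime (fun=> a).
Proof. by elim: a => [|a IHa b IHb]; [apply: ptime_Leaf | apply: ptime_Node]. Qed.

Definition ptimeb (p : btree -> bool) := ptime (fun x => enc_bool (p x)).

Lemma ptime_if p g h : ptimeb p -> ptime g -> ptime h ->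
  ptime (fun x => if p x then g x else h x).
Proof.
move=> pp pg ph.
apply: eq_ptime (ptime_comp (ptime_branch pg ph) (ptime_Node pp ptime_id)).
by move=> x /=; case: (p x).
Qed.

Lemma ptimeb_eq f g : ptime f -> ptime g -> ptimeb (fun x => f x == g x).
Proof. by move=> pf pg; apply: ptime_comp ptime_eq0 (ptime_Node pf pg). Qed.

Lemma ptimeb_if p q r : ptimeb p -> ptimeb q -> ptimeb r ->
  ptimeb (fun x => if p x then q x else r x).
Proof.
by move=> pp pq pr; apply: eq_ptime (ptime_if pp pq pr) => x /=; case: (p x).
Qed.

Lemma ptimeb_const b : ptimeb (fun=> b).
Proof. exact: ptime_const. Qed.

Lemma ptimeb_and p q : ptimeb p -> ptimeb q -> ptimeb (fun x => p x && q x).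
Proof. by move=> pp pq; apply: ptimeb_if pp pq (ptimeb_const false). Qed.

Lemma ptimeb_or p q : ptimeb p -> ptimeb q -> ptimeb (fun x => p x || q x).
Proof. by move=> pp pq; apply: ptimeb_if pp (ptimeb_const true) pq. Qed.

Lemma ptimeb_imply p q : ptimeb p -> ptimeb q -> ptimeb (fun x => p x ==> q x).
Proof. by move=> pp pq; apply: ptimeb_if pp pq (ptimeb_const true). Qed.

Lemma ptimeb_not p : ptimeb p -> ptimeb (fun x => ~~ p x).
Proof. by move=> pp; apply: ptimeb_if pp (ptimeb_const _) (ptimeb_const _). Qed.

(** The step may consult the original input [x], so [x] travels next to the accumulator and is
    dropped after the loop. *)
Lemma ptime_foldl (h : btree -> btree -> btree -> btree) l init f :
  ptime (fun z => h (hd z) (hd (tl z)) (tl (tl z))) -> ptime l -> ptime init ->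
  polyb f ->
  (forall x i, tsize (foldl (fun a e => h e a x) (init x) (take i (lst (l x))))
     <= f (tsize x)) ->
  ptime (fun x => foldl (fun a e => h e a x) (init x) (lst (l x))).
Proof.
move=> ph pl pi [k fk] hf.
pose h' z := Node (h (hd z) (hd (tl z)) (tl (tl z))) (tl (tl z)).
have ph' : ptime h' by apply: ptime_Node ph (ptime_tl (ptime_tl ptime_id)).
have h'E x a s : foldl (fun a e => h' (Node e a)) (Node a x) s =
    Node (foldl (fun a e => h e a x) a s) x.
  by elim: s a => //= e s IH a; rewrite -IH.
(* The size bound [hf] speaks only of loops started from such triples. *)
pose D z := exists x, z = Node (l x) (Node (init x) x).
pose z x := Node (l x) (Node (init x) x).
have pz : ptime z by apply: ptime_Node pl (ptime_Node pi ptime_id).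
have pit : ptime_on D (fun x => foldl (fun a e => h' (Node e a)) (tl x) (lst (hd x))).
  apply: (@ptime_iter _ _ (fun n => (n + 2) ^ k + n + 1) ph').
    by polyb.
  move=> _ i [x ->] /=; rewrite h'E /=.
  have := hf x i; have := fk (tsize x).
  have : (tsize x + 2) ^ k <= (tsize (z x) + 2) ^ k by rewrite leq_expl //= ; lia.
  rewrite /z /=; lia.
have := ptime_hd (ptime_on_comp pit pz (fun x => ex_intro _ x erefl)).
by apply: eq_ptime => x; rewrite /= h'E.
Qed.

(** Additive growth is harmless: the number of rounds is at most the size of the list, so the
    accumulator stays polynomial. *)
Lemma ptime_foldl_add (h : btree -> btree -> btree -> btree) l init f :
  ptime (fun z => h (hd z) (hd (tl z)) (tl (tl z))) -> ptime l -> ptime init ->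
  polyb f ->
  (forall x e a, e \in lst (l x) -> tsize (h e a x) <= tsize a + f (tsize x)) ->
  ptime (fun x => foldl (fun a e => h e a x) (init x) (lst (l x))).
Proof.
move=> ph pl pi pf hf; have [k lk] := ptime_tsize pl; have [k' ik] := ptime_tsize pi.
apply: (@ptime_foldl _ _ _ (fun n => (n + 2) ^ k' + (n + 2) ^ k * f n)) => //.
  by polyb.
move=> x i; set s := take i _.
have sl : size s <= (tsize x + 2) ^ k.
  rewrite size_take_min; apply: leq_trans (geq_minr _ _) _.
  exact: leq_trans (ltnW (size_lst _)) (lk x).
have {hf}: forall e a, e \in s -> tsize (h e a x) <= tsize a + f (tsize x).
  by move=> e a /mem_take; apply: hf.
move=> hf; apply: (@leq_trans (tsize (init x) + size s * f (tsize x))); last first.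
  by apply: leq_add => //; rewrite leq_mul2r sl orbT.
elim: s (init x) {sl ik} hf => [|e s IH] a hf /=; first by rewrite mul0n addn0.
apply: leq_trans (IH _ _) _ => [e' a' e's|]; first by rewrite hf // inE e's orbT.
by rewrite mulSn addnA leq_add2r hf // inE eqxx.
Qed.

Lemma tsize_mem e a : e \in lst a -> tsize e <= tsize a.
Proof.
elim: a => //= b _ r IH; rewrite inE => /orP[/eqP->|/IH]; lia.
Qed.

Lemma ptime_proj3 : [/\ ptime (fun z => hd z), ptime (fun z => hd (tl z))
  & ptime (fun z => tl (tl z))].
Proof.
split; first exact: ptime_hd0; first exact: ptime_hd ptime_tl0.
exact: ptime_tl ptime_tl0.
Qed.

(** A left fold that conses reverses its list, so this is the primitive loop; reversal,
    concatenation, maps and flattening are obtained from it or corrected by a final reversal. *)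
Definition catrev_t a b := foldl (fun a e => Node e a) b (lst a).

Lemma catrev_tE a b : catrev_t (tree a) (tree b) = tree (catrev a b).
Proof. by rewrite /catrev_t treeK; elim: a b => //= e a IH b; rewrite -IH. Qed.

Lemma ptime_catrev f g : ptime f -> ptime g -> ptime (fun x => catrev_t (f x) (g x)).
Proof.
move=> pf pg; have [k fk] := ptime_tsize pf; have [p1 p2 p3] := ptime_proj3.
apply: (@ptime_foldl_add (fun e a _ => Node e a) _ _ (fun n => (n + 2) ^ k + 1)) => //.
- exact: ptime_Node.
- by polyb.
- by move=> x e a /tsize_mem => H /=; have := leq_trans H (fk x); lia.
Qed.

Lemma ptime_rev f : ptime (fun x => tree (f x)) -> ptime (fun x => tree (rev (f x))).
Proof.
move=> pf; apply: eq_ptime (ptime_catrev pf ptime_Leaf) => x.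
by rewrite -[Leaf]/(tree [::]) catrev_tE.
Qed.

Lemma ptime_cat f g : ptime (fun x => tree (f x)) -> ptime (fun x => tree (g x)) ->
  ptime (fun x => tree (f x ++ g x)).
Proof.
move=> pf pg; apply: eq_ptime (ptime_catrev (ptime_rev pf) pg) => x.
by rewrite catrev_tE catrevE revK.
Qed.

Lemma ptime_map (f : btree -> btree -> btree) l :
  ptime (fun z => f (hd z) (tl z)) -> ptime (fun x => tree (l x)) ->
  ptime (fun x => tree [seq f e x | e <- l x]).
Proof.
move=> pf pl; have [k fk] := ptime_tsize pf; have [k' lk] := ptime_tsize pl.
have [p1 p2 p3] := ptime_proj3.
have H : ptime (fun x => tree (rev [seq f e x | e <- l x])).
  have := @ptime_foldl_add (fun e a x => Node (f e x) a) _ (fun=> Leaf)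
    (fun n => ((n + 2) ^ k' + n + 1 + 2) ^ k + 1) _ pl ptime_Leaf _ _.
  move=> H; apply: eq_ptime (H _ _ _).
  - move=> x /=; rewrite treeK -[Leaf]/(tree [::]) /rev.
    by elim: (l x) [::] => //= e s IH a; rewrite -IH.
  - by apply: ptime_Node p2; apply: ptime_comp pf (ptime_Node p1 p3).
  - by polyb.
  - move=> x e a ex /=.
    suff: tsize (f e x) <= ((tsize x + 2) ^ k' + tsize x + 1 + 2) ^ k by lia.
    apply: leq_trans (fk (Node e x)) _; rewrite leq_expl //= .
    have := leq_trans (tsize_mem ex) (lk x); lia.
by apply: eq_ptime (ptime_rev H) => x; rewrite revK.
Qed.

Lemma ptime_flatten (l : btree -> seq (seq btree)) :
  ptime (fun x => tree (map tree (l x))) -> ptime (fun x => tree (flatten (l x))).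
Proof.
move=> pl; have [k lk] := ptime_tsize pl; have [p1 p2 p3] := ptime_proj3.
have H : ptime (fun x => tree (rev (flatten (l x)))).
  apply: eq_ptime (@ptime_foldl_add (fun e a x => catrev_t e a) _ (fun=> Leaf)
    (fun n => (n + 2) ^ k) _ pl ptime_Leaf _ _).
  - move=> x /=; rewrite treeK -[Leaf]/(tree [::]) /rev.
    by elim: (l x) [::] => //= e s IH a; rewrite catrev_tE IH catrev_catl.
  - exact: ptime_catrev.
  - by polyb.
  - move=> x e a /tsize_mem H; apply: leq_trans (leq_add (leqnn _) (leq_trans H (lk x))).
    rewrite /catrev_t; elim: e a {H} => /= [|b _ r IH] a; first lia.
    by have := IH (Node b a); rewrite /=; lia.
by apply: eq_ptime (ptime_rev H) => x; rewrite revK.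
Qed.

Lemma ptimeb_has (p : btree -> btree -> bool) l :
  ptimeb (fun z => p (hd z) (tl z)) -> ptime (fun x => tree (l x)) ->
  ptimeb (fun x => has (fun e => p e x) (l x)).
Proof.
move=> pp pl; have [p1 p2 p3] := ptime_proj3.
apply: eq_ptime (@ptime_foldl_add (fun e a x =>
  if p e x then enc_bool true else a) _ (fun=> Leaf) (fun=> 3) _ pl ptime_Leaf _ _).
- move=> x; rewrite treeK; have E s b :
      foldl (fun a e => if p e x then enc_bool true else a) (enc_bool b) s =
      enc_bool (b || has (p^~ x) s).
    elim: s b => [|e s IH] b; first by rewrite orbF.
    rewrite [foldl _ _ _]/=; case pe: (p e x); first by rewrite (IH true) /= pe orbT.
    by rewrite IH /= pe.
  exact: (E _ false).
- by apply: ptime_if (ptime_const _) p2; apply: ptime_comp pp (ptime_Node p1 p3).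
- by polyb.
- by move=> x e a _; case: (p e x) => /=; lia.
Qed.

Lemma ptimeb_all (p : btree -> btree -> bool) l :
  ptimeb (fun z => p (hd z) (tl z)) -> ptime (fun x => tree (l x)) ->
  ptimeb (fun x => all (fun e => p e x) (l x)).
Proof.
move=> pp pl.
apply: eq_ptime (ptimeb_not (@ptimeb_has (fun e x => ~~ p e x) l _ pl)).
- by move=> x /=; rewrite has_predC negbK.
- exact: ptimeb_not.
Qed.

(** * Indices in unary *)

Definition un n := tree (nseq n Leaf).

Lemma un_inj : injective un.
Proof.
by move=> m n /(congr1 lst); rewrite !treeK => /(congr1 size); rewrite !size_nseq.
Qed.

Lemma tsize_un n : tsize (un n) = n.*2.+1.
Proof. by elim: n => //= n IH; rewrite -/(un n) IH /=; lia. Qed.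

(** The accumulator lists the numerals produced so far, last one first. Its length is the next
    index, so replacing all its entries by [Leaf] yields the next numeral. *)
Lemma ptime_iota (l : btree -> seq btree) : ptime (fun x => tree (l x)) ->
  ptime (fun x => tree (map un (iota 0 (size (l x))))).
Proof.
move=> pl; have [p1 p2 p3] := ptime_proj3; have [k lk] := ptime_tsize pl.
have E (s : seq btree) : foldl (fun a e => Node (tree [seq Leaf | _ <- lst a]) a) Leaf s =
    tree (rev (map un (iota 0 (size s)))).
  elim/last_ind: s => // s e IH; rewrite foldl_rcons IH treeK size_rcons.
  rewrite -[(size s).+1]addn1 iotaD map_cat rev_cat /= add0n; congr Node.
  have -> t : [seq Leaf | _ <- t] = nseq (size t) Leaf by elim: t => // b t /= ->.
  by rewrite size_rev size_map size_iota.
have H : ptime (fun x => tree (rev (map un (iota 0 (size (l x)))))).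
  apply: eq_ptime (@ptime_foldl
    (fun e a x => Node (tree [seq Leaf | _ <- lst a]) a) _ (fun=> Leaf)
    (fun n => ((n + 2) ^ k) * ((n + 2) ^ k * 2 + 2) + 1) _ pl ptime_Leaf _ _).
  - by move=> x; rewrite treeK E.
  - apply: ptime_Node (p2); apply: (@ptime_map (fun _ _ => Leaf)); first exact: ptime_Leaf.
    by apply: eq_ptime p2 => x; rewrite lstK.
  - by polyb.
  - move=> x i; rewrite treeK E.
    have: size (take i (l x)) <= (tsize x + 2) ^ k.
      rewrite size_take_min; apply: leq_trans (geq_minr _ _) _.
      by apply: leq_trans (lk x); rewrite ltnW // -[in size _](treeK (l x)) size_lst.
    move: (size _) => m mk; rewrite addn1; apply: (@leq_trans (m * (m * 2 + 2)).+1); last nia.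
    have G B r : all (fun j => j.*2.+2 <= B) r ->
        tsize (tree (map un r)) <= (size r * B).+1.
      elim: r => //= j r IH /andP[jB /IH]; rewrite tsize_un mulSn; lia.
    rewrite -map_rev; apply: leq_trans (G (m * 2 + 2) _ _) _.
      by apply/allP => j; rewrite mem_rev mem_iota; lia.
    by rewrite size_rev size_iota.
by apply: eq_ptime (ptime_rev H) => x; rewrite revK.
Qed.

Definition nth_t (a i : btree) := hd (foldl (fun a _ => tl a) a (lst i)).

Lemma nth_tE s i : nth_t (tree s) (un i) = nth Leaf s i.
Proof.
rewrite /nth_t treeK; elim: i s => [|i IH] [|e s] //=; rewrite -?IH //.
by rewrite -[Leaf]/(tree [::]) IH nth_nil.
Qed.

Lemma ptime_nth f g : ptime f -> ptime g -> ptime (fun x => nth_t (f x) (g x)).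
Proof.
move=> pf pg; have [p1 p2 p3] := ptime_proj3; apply: ptime_hd.
apply: (@ptime_foldl_add (fun _ a _ => tl a) _ _ (fun=> 0)) => //.
- exact: ptime_tl.
- by polyb.
- by move=> x e a _; rewrite addn0 tsize_tl.
Qed.

(** * Calling an algorithm between two polynomial-time functions *)

Fixpoint expr_bound (e : expr) : nat :=
  match e with
  | EVar x => x.+1
  | ENil => 0
  | ECons e1 e2 | EEq e1 e2 => maxn (expr_bound e1) (expr_bound e2)
  | EHd e1 | ETl e1 => expr_bound e1
  end.

Fixpoint cmd_bound (c : cmd) : nat :=
  match c with
  | Assign x e => maxn x.+1 (expr_bound e)
  | Defs.Seq c1 c2 => maxn (cmd_bound c1) (cmd_bound c2)
  | If e c1 c2 => maxn (expr_bound e) (maxn (cmd_bound c1) (cmd_bound c2))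
  | While e c1 => maxn (expr_bound e) (cmd_bound c1)
  end.

Lemma eval_frame e b (s s2 : store) : expr_bound e <= b ->
  (forall y, y < b -> s2 y = s y) -> eval e s2 = eval e s /\ ecost e s2 = ecost e s.
Proof.
move=> eb ss2; elim: e eb => /=.
- by move=> x xb; rewrite ss2.
- by [].
- by move=> e1 IH1 e2 IH2; rewrite geq_max => /andP[/IH1[-> ->] /IH2[-> ->]].
- by move=> e IH /IH[-> ->].
- by move=> e IH /IH[-> ->].
- by move=> e1 IH1 e2 IH2; rewrite geq_max => /andP[/IH1[-> ->] /IH2[-> ->]].
Qed.

(** The given algorithm is an arbitrary program that need not restore its variables. It cannot read
    or write a variable from its bound on, so data can be parked there during the call. *)
Lemma exec_frame c b (s : store) t s' : exec c s t s' -> cmd_bound c <= b ->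
  forall s2 : store, (forall y, y < b -> s2 y = s y) -> exists s2', [/\ exec c s2 t s2',
    (forall y, y < b -> s2' y = s' y) & (forall y, b <= y -> s2' y = s2 y)].
Proof.
elim=> {c s t s'} /=.
- move=> x e s; rewrite geq_max => /andP[xb eb] s2 ss2.
  have [ee ce] := eval_frame eb ss2.
  exists (update s2 x (eval e s2)); rewrite -ce; split; first exact: exec_assign.
  + by move=> y yb; rewrite !updateE ee ss2.
  + by move=> y yb; rewrite updateE gtn_eqF // (leq_trans xb).
- move=> c1 c2 s t1 s1 t2 s2 _ IH1 _ IH2; rewrite geq_max => /andP[b1 b2] r sr.
  have [r1 [E1 sr1 rr1]] := IH1 b1 r sr; have [r2 [E2 sr2 rr2]] := IH2 b2 r1 sr1.
  exists r2; split=> //; first exact: exec_seq E1 E2.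
  by move=> y yb; rewrite rr2 // rr1.
- move=> e c1 c2 s t s1 es _ IH; rewrite !geq_max => /and3P[eb b1 b2] r sr.
  have [ee ce] := eval_frame eb sr; have [r1 [E1 sr1 rr1]] := IH b1 r sr.
  by exists r1; split=> //; rewrite -ce; apply: exec_if_true => //; rewrite ee.
- move=> e c1 c2 s t s1 es _ IH; rewrite !geq_max => /and3P[eb b1 b2] r sr.
  have [ee ce] := eval_frame eb sr; have [r1 [E1 sr1 rr1]] := IH b2 r sr.
  by exists r1; split=> //; rewrite -ce; apply: exec_if_false => //; rewrite ee.
- move=> e c s t1 s1 t2 s2 es _ IH1 _ IH2 b1 r sr.
  have := b1; rewrite geq_max => /andP[eb cb]; have [ee ce] := eval_frame eb sr.
  have [r1 [E1 sr1 rr1]] := IH1 cb r sr; have [r2 [E2 sr2 rr2]] := IH2 b1 r1 sr1.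
  exists r2; split=> //; last by move=> y yb; rewrite rr2 // rr1.
  by rewrite -ce; apply: exec_while_true E1 E2; rewrite ee.
- move=> e c s es; rewrite geq_max => /andP[eb cb] r sr.
  have [ee ce] := eval_frame eb sr; exists r; split=> //.
  by rewrite -ce; apply: exec_while_false; rewrite ee.
Qed.

(** After the call the low variables hold arbitrary values, whereas the next program expects empty
    temporaries. The language has no empty command, so the base case is a harmless assignment. *)
Fixpoint clear b :=
  if b is b'.+1 then Defs.Seq (Assign b ENil) (clear b') else Assign 1 ENil.

Lemma exec_clear b (s : store) : exists s', [/\ exec (clear b) s b.+1 s', s' 0 = s 0,
  (forall y, 0 < y <= b -> s' y = Leaf)
  & (forall y, s y = Leaf -> s' y = Leaf)].
Proof.
elim: b s => [|b IH] s /=.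
  exists (update s 1 Leaf); split=> //; first exact: (exec_assign 1 ENil s).
    by case=> [|y].
  by move=> y sy; rewrite updateE sy if_same.
have [s' [E s'0 s'b s'y]] := IH (update s b.+1 Leaf); exists s'; split.
- exact: (exec_seq (exec_assign b.+1 ENil s) E).
- by rewrite s'0.
- move=> y /andP[y0]; rewrite leq_eqVlt => /orP[/eqP->|yb].
    by rewrite s'y // update_eq.
  by rewrite s'b // y0.
- by move=> y sy; rewrite s'y // updateE sy if_same.
Qed.

(** The input is parked in a variable above all those of [c] and the temporaries of [pre], so that
    [post] receives both the instance and the output of the call. *)
Theorem turing_reduction pre post c (p : {poly nat}) : ptime pre -> ptime post ->
  exists c' (p' : {poly nat}), forall x t out,
    runs c (pre x) t out -> t <= p.[tsize (pre x)]%R ->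
    exists2 t', runs c' x t' (post (Node x out)) & t' <= p'.[tsize x]%R.
Proof.
move=> pp; have [l pl] := ptime_tsize pp; have [kp kpP] := polyb_horner p.
case: pp => [cp [bp [k1 Hp]]] [cq [bq [k2 Hq]]].
pose b := (maxn (cmd_bound c) bp).+1.
(* [F] bounds the running time of [c] on [pre x] in terms of the size of [x]; [S] bounds its output,
   whose size is at most that of [pre x] plus this time. *)
pose F n := ((n + 2) ^ l + 2) ^ kp.
pose S n := (n + 2) ^ l + F n.
have [p' p'P] : exists p' : {poly nat}, forall n, n + ((n + 2) ^ k1 + (F n +
    ((1 + (n + S n) + (n + S n)) + (b.+1 + (1 + (n + S n) + 2) ^ k2)))) <= p'.[n]%R.
  by apply: polyb_poly; rewrite /S /F; polyb.
exists (Defs.Seq (Assign b (EVar 0)) (Defs.Seq cp (Defs.Seq c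
  (Defs.Seq (Assign 0 (ECons (EVar b) (EVar 0))) (Defs.Seq (clear b) cq))))), p'.
move=> x t out [r [Er rout]] tp; have {}tp := leq_trans tp (kpP _).
pose s0 := update (fun=> Leaf) 0 x; pose s1 := update s0 b x.
have bp' y : y < bp -> y < b by rewrite ltnS leq_max => /ltnW ->; rewrite orbT.
have [y /andP[y0 yb]|t2 [s2 [E2 s20 s2y t2k]]] := Hp s1.
  by rewrite /s1 /s0 !updateE ltn_eqF ?bp' // gtn_eqF.
have s10 : s1 0 = x by [].
rewrite s10 in s20 t2k.
have [||s3 [E3 s3r s3y]] := @exec_frame c b _ _ _ Er _ s2.
- by rewrite /b; lia.
- move=> [|y] yb; first by rewrite s20.
  by rewrite s2y // /s1 /s0 !updateE ltn_eqF.
have s30 : s3 0 = out by rewrite s3r.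
have s3b : s3 b = x by rewrite s3y // s2y // /s1 update_eq.
pose s4 := update s3 0 (Node x out).
have [s5 [E5 s50 s5b s5y]] := exec_clear b s4.
have s4y y : b < y -> s4 y = Leaf.
  move=> yb; have y0 := leq_ltn_trans (leq0n _) yb.
  rewrite /s4 updateE gtn_eqF // s3y 1?ltnW // s2y // /s1 /s0 !updateE.
  by rewrite gtn_eqF // gtn_eqF.
have [y /andP[y0 yq]|t6 [s6 [E6 s60 s6y t6k]]] := Hq s5.
  by case: (leqP y b) => yb; [rewrite s5b ?y0 | rewrite s5y // s4y].
have out_t : tsize out <= tsize (pre x) + t.
  by rewrite -rout; have := exec_tsize Er 0; rewrite update_eq.
have tF : t <= F (tsize x) by apply: leq_trans tp _; rewrite leq_expl // leq_add2r.
have outS : tsize out <= S (tsize x) by apply: leq_trans out_t _; rewrite leq_add.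
eexists; last apply: leq_trans (p'P _).
  exists s6; split; last by rewrite s60 s50.
  apply: exec_seq (exec_assign _ _ _) _; rewrite -/s0 /= -/s1.
  apply: exec_seq E2 _; apply: exec_seq E3 _.
  apply: exec_seq (exec_assign _ _ _) _ => /=; rewrite s3b s30 -/s4.
  exact: exec_seq E5 E6.
rewrite /= s3b s30 !addn0; apply: leq_add => //; apply: leq_add => //.
apply: leq_add => //; apply: leq_add.
  by rewrite update_eq; move: (S (tsize x)) outS => N; clear; lia.
apply: leq_add => //; apply: leq_trans t6k _; rewrite s50 /s4 update_eq.
by rewrite leq_expl //=; move: (S (tsize x)) outS => N; clear; lia.
Qed.

(** * Stable graphs and tight pairs of a cover and a matching *)

Section Slackness.

Local Open Scope ring_scope.
Variables (R : realType) (G : sgraph).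
Local Notation V := 'I_(nvertices G).
Implicit Types (w c : {set V} -> R) (y : V -> R) (M : {set {set V}}) (u v : V).

Lemma adj_neq u v : adj u v -> u != v.
Proof. by apply: contraTneq => ->; rewrite adj_irr. Qed.

Lemma edgesP (e : {set V}) :
  reflect (exists u v, adj u v /\ e = [set u; v]) (e \in edges G).
Proof.
apply: (iffP imsetP) => [[[u v] /= uv ->]|[u [v [uv ->]]]]; first by exists u, v.
by exists (u, v).
Qed.

Lemma mem_edges u v : ([set u; v] \in edges G) = adj u v.
Proof.
apply/edgesP/idP => [[a [b [ab E]]]|uv]; last by exists u, v.
have ua : u \in [set a; b] by rewrite -E set21.
have va : v \in [set a; b] by rewrite -E set22.
have au : a \in [set u; v] by rewrite E set21.
have bu : b \in [set u; v] by rewrite E set22.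
move: ua va au bu (adj_neq ab); rewrite !in_set2.
case/orP=> /eqP->; case/orP=> /eqP->; rewrite ?eqxx ?orbb //=.
- by move=> _ /eqP->; rewrite eqxx.
- by rewrite adj_sym.
- by move=> /eqP->; rewrite eqxx.
Qed.

Lemma big_edge (F : V -> R) u v : u != v -> \sum_(x in [set u; v]) F x = F u + F v.
Proof. by move=> uv; rewrite big_setU1 ?big_set1 // in_set1. Qed.

(** Complementary slackness in additive form: all terms of the gap are nonnegative, so a zero gap
    makes each of them vanish. *)
Lemma matching_weight w y M : fractional_vertex_cover w y -> matching M ->
  \sum_v y v - \sum_(e in M) w e =
    \sum_(e in M) (\sum_(v in e) y v - w e) + \sum_(v | v \notin cover M) y v
  /\ (forall e, e \in M -> 0 <= \sum_(v in e) y v - w e).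
Proof.
move=> [y0 yw] /andP[Me Mt]; split.
  have -> : \sum_v y v = \sum_(v in cover M) y v + \sum_(v | v \notin cover M) y v.
    by rewrite (bigID (mem (cover M))).
  by rewrite big_trivIset //= sumrB addrAC.
move=> e /(subsetP Me) /edgesP[u [v [uv ->]]].
by rewrite big_edge ?adj_neq // subr_ge0 yw.
Qed.

Lemma weak_duality w y M : fractional_vertex_cover w y -> matching M ->
  \sum_(e in M) w e <= \sum_v y v.
Proof.
move=> yw Mm; rewrite -subr_ge0; have [-> Me] := matching_weight yw Mm.
by rewrite addr_ge0 // sumr_ge0 // => v _; case: yw => ->.
Qed.

(** The matching is encoded as an involution whose fixed points are the exposed vertices. *)
Definition tight w y (mate : V -> V) := [/\ fractional_vertex_cover w y,
  involutive mate, forall v, mate v = v -> y v = 0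
  & forall v, mate v != v -> adj v (mate v) /\ w [set v; mate v] = y v + y (mate v)].

Lemma stable_tight w : stable w -> exists y mate, tight w y mate.
Proof.
move=> [[y [yw yn]] _].
have [M [Mm Mw]] : exists M, matching M /\ \sum_(e in M) w e = nu w.
  (* The maximum is attained; its default value 0 is the weight of the empty matching. *)
  rewrite /nu; elim/big_ind: _ => [|a b [M [Mm <-]] [N [Nm <-]]|M Mm].
  - exists set0; rewrite big_set0; split => //.
    rewrite /matching sub0set /=; apply/trivIsetP => A B; by rewrite inE.
  - by case: (leP (\sum_(e in M) w e)) => _; [exists N|exists M].
  - by exists M.
have [E Me] := matching_weight yw Mm; have y0 := yw.1.
move: E; rewrite yn Mw subrr => /esym/eqP; rewrite paddr_eq0; first last.
- by apply: sumr_ge0 => v _.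
- by apply: sumr_ge0.
rewrite !psumr_eq0 //= => /andP[/allP tM /allP uM].
have /andP[Msub Mt] := Mm.
have edge_pblock v : v \in cover M -> exists2 u, adj v u & pblock M v = [set v; u].
  move=> vM; have := pblock_mem vM => /(subsetP Msub) /edgesP[a [b [ab E]]].
  have : v \in pblock M v by rewrite mem_pblock.
  rewrite E in_set2 => /orP[] /eqP ->; first by exists b.
  by exists a; rewrite 1?adj_sym // setUC.
(* The other end of the matching edge at [v], or [v] itself when [v] is exposed. *)
pose mate v := odflt v [pick u | (v \in cover M) && (pblock M v == [set v; u])].
have mateP v : if v \in cover M then adj v (mate v) /\ pblock M v = [set v; mate v]
    else mate v = v.
  rewrite /mate; case: pickP => [u /andP[-> /eqP E]|no] /=.
    by split=> //; rewrite -mem_edges -E (subsetP Msub) // pblock_mem //;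
      rewrite -mem_pblock E set21.
  case: ifP no => // vM no; have [u vu E] := edge_pblock v vM.
  by have := no u; rewrite E eqxx.
exists y, mate; split=> //.
- move=> v; have := mateP v; case: ifP => [vM [vm E]|nM ->].
    have mM : mate v \in pblock M v by rewrite E set22.
    have [vM' E'] : mate v \in cover M /\ pblock M (mate v) = pblock M v.
      split; first by rewrite -mem_pblock (same_pblock Mt mM) mM.
      exact: same_pblock.
    have := mateP (mate v); rewrite vM' E' E => -[mm Em].
    have : v \in [set mate v; mate (mate v)] by rewrite -Em set21.
    by rewrite in_set2 (negPf (adj_neq vm)) => /eqP.
  by have := mateP v; rewrite nM.
- move=> v vm; apply/eqP; have := uM v; rewrite mem_index_enum => /(_ isT) /implyP; apply.
  by apply/negP => vM; have := mateP v; rewrite vM => -[/adj_neq]; rewrite vm eqxx.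
- move=> v vm; have := mateP v; case: ifP => [vM [am E]|nM mv]; last by rewrite mv eqxx in vm.
  split=> //; have := tM [set v; mate v]; rewrite mem_index_enum => /(_ isT) /implyP.
  rewrite -E pblock_mem // => /(_ isT); rewrite E big_edge ?adj_neq //.
  by rewrite subr_eq0 => /eqP ->.
Qed.

Section Mate.

Variable mate : V -> V.
Hypothesis mateK : involutive mate.
Hypothesis mate_adj : forall v, mate v != v -> adj v (mate v).

Definition mate_edges : {set {set V}} := [set [set v; mate v] | v in [pred v | mate v != v]].

Lemma mate_edgesP e v : e \in mate_edges -> v \in e -> mate v != v /\ e = [set v; mate v].
Proof.
case/imsetP => u um ->; rewrite in_set2 => /orP[/eqP-> //|/eqP->].
by rewrite mateK setUC eq_sym.
Qed.

Lemma mate_matching : matching mate_edges.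
Proof.
apply/andP; split.
  by apply/subsetP => _ /imsetP[v vm ->]; rewrite mem_edges mate_adj.
apply/trivIsetP => A B AM BM; apply: contraR => /pred0Pn[v /andP[/= vA vB]].
by have [_ ->] := mate_edgesP AM vA; have [_ <-] := mate_edgesP BM vB.
Qed.

Lemma mate_cover v : (v \in cover mate_edges) = (mate v != v).
Proof.
apply/bigcupP/idP => [[e eM ve]|vm]; first by have [] := mate_edgesP eM ve.
by exists [set v; mate v]; [apply: imset_f | rewrite set21].
Qed.

Lemma sum_mate_edges (F : V -> R) :
  \sum_(e in mate_edges) \sum_(v in e) F v = \sum_(v | mate v != v) F v.
Proof.
have /andP[_ Mt] := mate_matching; rewrite -(big_trivIset _ Mt).
by apply: eq_bigl => v; rewrite mate_cover.
Qed.

End Mate.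

(** The matching weighs exactly as much as the cover, so weak duality certifies both as optimal. *)
Lemma tight_stable w y mate : tight w y mate -> stable w.
Proof.
move=> [yw mateK y0 ymate].
have madj v : mate v != v -> adj v (mate v) by case/ymate.
have Mm := mate_matching mateK madj.
have Mw : \sum_(e in mate_edges mate) w e = \sum_v y v.
  transitivity (\sum_(e in mate_edges mate) \sum_(v in e) y v).
    apply: eq_bigr => _ /imsetP[v vm ->]; have [vadj ->] := ymate v vm.
    by rewrite big_edge ?adj_neq.
  rewrite sum_mate_edges // [RHS](bigID (fun v => mate v != v)) /=.
  by rewrite [X in _ = _ + X]big1 ?addr0 // => v; rewrite negbK => /eqP /y0.
have nuE : nu w = \sum_v y v.
  apply/eqP; rewrite eq_le; apply/andP; split.
    rewrite /nu; elim/big_ind: _ => [|a b ha hb|M MM].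
    - by apply: sumr_ge0 => v _; case: yw.
    - by rewrite ge_max ha.
    - exact: weak_duality.
  by rewrite -Mw /nu (bigD1 _ Mm) /= le_max lexx.
rewrite /stable nuE; split; first by exists y.
by move=> y' y'w; rewrite -Mw; apply: weak_duality.
Qed.

(** Weight is added only on matching edges, just enough to make them tight: [y u + y v - 1].
    Charging half of the 1 to each end turns the cost into a sum over matched vertices. *)
Lemma stabilizer_of_mate y mate : (forall v, 0 <= y v) ->
  (forall u v, adj u v -> 1 <= y u + y v) -> involutive mate ->
  (forall v, mate v = v -> y v = 0) -> (forall v, mate v != v -> adj v (mate v)) ->
  exists2 c, additive_stabilizer c &
    \sum_(e in edges G) c e = \sum_(v | mate v != v) (y v - 2^-1).
Proof.
move=> y_ge0 ycov mateK y0 madj.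
pose c e := if e \in mate_edges mate then \sum_(v in e) (y v - 2^-1) else 0.
have cE u v : adj u v -> \sum_(x in [set u; v]) (y x - 2^-1) = y u + y v - 1.
  by move=> uv; rewrite big_edge ?adj_neq //; lra.
have /andP[Msub _] := mate_matching mateK madj.
exists c; last first.
  rewrite -sum_mate_edges // big_mkcond [RHS]big_mkcond /=; apply: eq_bigr => e _.
  rewrite /c; case: ifP => [_ //|/negP ne]; case: ifP => // /(subsetP Msub) //.
split.
  move=> e /edgesP[u [v [uv ->]]]; rewrite /c; case: ifP => // _.
  by rewrite cE // subr_ge0 ycov.
apply: (@tight_stable _ y mate); split=> //.
- split=> // u v uv; rewrite /c; case: ifP => _; last by rewrite addr0 ycov.
  by rewrite cE // addrC subrK.
- move=> v vm; split; first exact: madj.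
  have vM : [set v; mate v] \in mate_edges mate by apply: imset_f.
  by rewrite /c vM cE ?madj // addrC subrK.
Qed.

(** Double counting: an edge is chosen only by its ends lying in [U], hence at most [r] times. *)
Lemma sum_edges_ge c (U : {pred V}) (g : V -> V) r :
  (forall e, e \in edges G -> 0 <= c e) -> {in U, forall v, adj v (g v)} ->
  (forall u v, adj u v -> (u \in U) + (v \in U) <= r)%N ->
  \sum_(v in U) c [set v; g v] <= r%:R * \sum_(e in edges G) c e.
Proof.
move=> c0 gadj Ur.
rewrite (partition_big (fun v => [set v; g v]) (mem (edges G))) /=; last first.
  by move=> v vU; rewrite mem_edges gadj.
rewrite mulr_sumr; apply: ler_sum => e eE.
rewrite (eq_bigr (fun=> c e)); last by move=> v /andP[_ /eqP->].
rewrite sumr_const -[_ *+ _]mulr_natl ler_wpM2r ?c0 // ler_nat.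
case/edgesP: eE => a [b [ab ->]]; apply: leq_trans (Ur a b ab).
rewrite -sum1_card big_mkcond /=.
apply: (@leq_trans (\sum_(v in [set a; b]) (v \in U))%N).
  rewrite [leqRHS]big_mkcond; apply: leq_sum => v _; rewrite !inE.
  case: ifP => // /andP[vU /eqP E]; rewrite vU.
  by rewrite -in_set2 -E set21.
by rewrite big_setU1 ?big_set1 // in_set1 adj_neq.
Qed.

End Slackness.

(** * The graph of a set system *)

(** Orbits of size two are removed one at a time. Applied to matchings, this parity bound shows that
    an odd clique cannot be perfectly matched within itself. *)
Lemma involution_even (T : finType) (f : T -> T) (A : {set T}) : involutive f ->
  (forall x, x \in A -> f x \in A /\ f x != x) -> ~~ odd #|A|.
Proof.
move=> fK; have [n] := ubnP #|A|; elim: n A => // n IH A An Af.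
have [->|[x xA]] := set_0Vmem A; first by rewrite cards0.
have [fxA fx] := Af x xA.
have E : #|A| = #|A :\ x :\ f x|.+2.
  by rewrite (cardsD1 x) xA (cardsD1 (f x) (A :\ x)) !inE fx fxA.
rewrite E /= negbK IH //; first by move: An; rewrite E; lia.
move=> y; rewrite !inE => /and3P[yfx yx yA]; have [fyA fy] := Af y yA; split=> //.
rewrite fyA andbT (inj_eq (inv_inj fK)) yx /=.
by apply: contra yfx => /eqP <-; rewrite fK.
Qed.

Definition fin_graph (T : finType) (e : rel T) (es : symmetric e) (ei : irreflexive e) :
  sgraph := @SGraph #|T| (fun u v => e (enum_val u) (enum_val v))
    (fun u v => es _ _) (fun u => ei _).

Section FinGraph.

Local Open Scope ring_scope.
Variables (R : realType) (T : finType) (e : rel T).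
Hypotheses (es : symmetric e) (ei : irreflexive e).
Let G := fin_graph es ei.
Implicit Types (c : {set 'I_(nvertices G)} -> R) (s t u : T).

Definition pair_weight c t u := c [set enum_rank t; enum_rank u].

Lemma fin_stabilizer c : additive_stabilizer c -> exists (y : T -> R) (mate : T -> T),
  [/\ forall t, 0 <= y t, forall t u, e t u -> 1 <= y t + y u, involutive mate,
      forall t, mate t = t -> y t = 0
    & forall t, mate t != t ->
        e t (mate t) /\ pair_weight c t (mate t) = y t + y (mate t) - 1].
Proof.
move=> [c0 /stable_tight[y [mate [[y0 yc] mateK m0 m1]]]].
exists (y \o enum_rank), (fun t => enum_val (mate (enum_rank t))); split.
- by move=> t; apply: y0.
- move=> t u tu.
  have A : adj (enum_rank t : 'I_(nvertices G)) (enum_rank u) by rewrite /= !enum_rankK.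
  apply: le_trans (yc _ _ A); rewrite lerDl; apply: c0; by rewrite mem_edges.
- by move=> t /=; rewrite enum_valK mateK enum_rankK.
- by move=> t /= E; apply: m0; rewrite -[LHS]enum_valK E.
- move=> t /= E; have [|A W] := m1 (enum_rank t).
    by apply: contra E => /eqP->; rewrite enum_rankK.
  rewrite /pair_weight enum_valK -W addrC addKr; split=> //.
  by move: A; rewrite /= enum_rankK.
Qed.

Lemma pair_weight_ge0 c t u : additive_stabilizer c -> e t u -> 0 <= pair_weight c t u.
Proof. by move=> [c0 _] tu; apply: c0; rewrite mem_edges /= !enum_rankK. Qed.

Lemma card_heavy_le c (U : {set T}) (g : T -> T) r (q : R) : additive_stabilizer c ->
  (forall t, t \in U -> e t (g t) /\ q <= pair_weight c t (g t)) ->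
  (forall t u, e t u -> (t \in U) + (u \in U) <= r)%N ->
  #|U|%:R * q <= r%:R * \sum_(f in edges G) c f.
Proof.
move=> [c0 _] Ug Ur.
pose U' := [pred v : 'I_(nvertices G) | enum_val v \in U].
apply: le_trans (@sum_edges_ge R G c U' (fun v => enum_rank (g (enum_val v))) r c0 _ _).
- rewrite (reindex (@enum_rank T)) /=; last exact/onW_bij/enum_rank_bij.
  rewrite (eq_bigl (mem U)); last by move=> t; rewrite inE enum_rankK.
  rewrite mulr_natl -sumr_const; apply: ler_sum => t tU; rewrite enum_rankK.
  by have [] := Ug t tU.
- by move=> v /Ug[? _]; rewrite /= enum_rankK.
- by move=> u v; apply: Ur.
Qed.

Lemma fin_stabilizer_of_mate (y : T -> R) (mate : T -> T) : (forall t, 0 <= y t) ->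
  (forall t u, e t u -> 1 <= y t + y u) -> involutive mate ->
  (forall t, mate t = t -> y t = 0) -> (forall t, mate t != t -> e t (mate t)) ->
  exists2 c, @additive_stabilizer R G c &
    \sum_(f in edges G) c f = \sum_(t | mate t != t) (y t - 2^-1).
Proof.
move=> y0 yc mateK m0 m1; pose mate' (v : 'I_(nvertices G)) := enum_rank (mate (enum_val v)).
have mE t : (mate' (enum_rank t) != enum_rank t) = (mate t != t).
  by rewrite /mate' enum_rankK (inj_eq enum_rank_inj).
have [||v|v E|v|c cs cE] := @stabilizer_of_mate R G (fun v => y (enum_val v)) mate'.
- by move=> v; apply: y0.
- by move=> u v; apply: yc.
- by rewrite /mate' enum_rankK mateK enum_valK.
- by apply: m0; rewrite -[LHS](enum_rankK) -/(mate' v) E.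
- by rewrite -[v]enum_valK mE /mate' /= !enum_rankK; apply: m1.
exists c => //; rewrite cE (reindex (@enum_rank T)) /=; last exact/onW_bij/enum_rank_bij.
by apply: eq_big => [t|t _]; [rewrite mE | rewrite enum_rankK].
Qed.

End FinGraph.

Section Reduction.

Variable X : set_system.
Local Notation m := (n_elements X).
Local Notation n := (n_sets X).

(** The factor 6 makes the overhead [m * n] of the element cliques at most a sixth of
    [#|I| * ncopies] for nonempty [I]; the successor keeps the number positive when [m * n] is 0. *)
Definition ncopies := (6 * (m * n)).+1.
(* After removing four vertices, half of a clique still has n * ncopies vertices. *)
Definition nclique := 2 * (n * ncopies).+2.

(* [inl (j, o)]: the clique of the element j, with two vertices for every set and
   one more.  [inr ((i, k), l)]: the clique of the k-th copy of the set i; only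
   its vertex l = 0 is joined to element vertices. *)
Definition vertex : finType :=
  ('I_m * option ('I_n * bool) + 'I_n * 'I_ncopies * 'I_nclique)%type.

(** For a set not containing [j] the implication is vacuous, and such a vertex, like the root, sees
    every set. Thus each vertex of the clique sees some set containing [j] if there is one. *)
Definition linked (j : 'I_m) (o : option ('I_n * bool)) (i : 'I_n) : bool :=
  if o is Some (i', _) then (j \in member i') ==> (i' == i) else true.

Definition vadj (u v : vertex) : bool :=
  match u, v with
  | inl (j, o), inl (j', o') => (j == j') && (o != o')
  | inr (a, l), inr (a', l') => (a == a') && (l != l')
  | inl (j, o), inr (a, l) | inr (a, l), inl (j, o) =>
      (l == 0 :> nat) && linked j o a.1
  end.

Lemma vadj_sym : symmetric vadj.
Proof.
by move=> [[j o]|[a l]] [[j' o']|[a' l']] //=; rewrite eq_sym [X in ~~ X]eq_sym.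
Qed.

Lemma vadj_irr : irreflexive vadj.
Proof. by move=> [[j o]|[a l]] /=; rewrite !eqxx. Qed.

Definition reduction : sgraph := fin_graph vadj_sym vadj_irr.

Lemma nclique_gt0 : 0 < nclique. Proof. by rewrite /nclique; lia. Qed.
Definition port : 'I_nclique := Ordinal nclique_gt0.

Definition covers (I : {set 'I_n}) := \bigcup_(i in I) member i == setT.

Lemma coversP (I : {set 'I_n}) :
  reflect (forall j, exists2 i, i \in I & j \in member i) (covers I).
Proof.
apply: (iffP eqP) => [E j|H].
  have /bigcupP[i iI ij] : j \in \bigcup_(i in I) member i by rewrite E inE.
  by exists i.
by apply/setP => j; rewrite inE; have [i iI ji] := H j; apply/bigcupP; exists i.
Qed.

Local Open Scope ring_scope.
Variable R : realType.
Implicit Types c : {set 'I_(nvertices reduction)} -> R.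
Local Notation cost c := (\sum_(f in edges reduction) c f).

(** In each element clique one vertex of a chosen covering set [sel j] is exposed. The other [2 * n]
    vertices get value 1 and contribute 1/2 each, in total [m * n]. Set cliques have value 1/2,
    except that the ports of the sets in [I] are raised to 1, contributing 1/2 per copy. *)
Lemma cover_stabilizer (I : {set 'I_n}) : covers I -> exists2 c : _ -> R,
  @additive_stabilizer R reduction c
  & cost c = (m * n)%:R + (#|I| * ncopies)%:R / 2.
Proof.
move=> /coversP cov.
have /(_ _)/sig2_eqW selP : forall j, exists2 i, i \in I & j \in member i by [].
pose sel j := s2val (selP j).
have selI j : sel j \in I by rewrite /sel; case: (selP j).
have jsel j : j \in member (sel j) by rewrite /sel; case: (selP j).
pose y (t : vertex) : R := match t with
  | inl (j, o) => if o == Some (sel j, false) then 0 else 1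
  | inr (a, l) => if (l == port) && (a.1 \in I) then 1 else 2^-1 end.
(* The vertex [(i, false)] is exposed, its twin [(i, true)] is matched to the root, and all other
   twins are matched to each other. *)
pose mo i (o : option ('I_n * bool)) := match o with
  | None => Some (i, true)
  | Some (i', b) => if i' == i then (if b then None else o) else Some (i', ~~ b) end.
pose mate (t : vertex) : vertex := match t with
  | inl (j, o) => inl (j, mo (sel j) o)
  | inr (a, l) => inr (a, rev_ord l) end.
have moK i : involutive (mo i).
  move=> [[i' b]|] /=; last by rewrite eqxx.
  case: (i' =P i) => [->|/eqP ne] /=; last by rewrite (negPf ne) negbK.
  by case: b => /=; rewrite ?eqxx.
have mo_fix i o : (mo i o == o) = (o == Some (i, false)).
  case: o => [[i' b]|] //=; case: (i' =P i) => [->|/eqP ne].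
    by case: b; rewrite ?eqxx // !(inj_eq Some_inj) xpair_eqE andbF.
  rewrite !(inj_eq Some_inj) !xpair_eqE (negPf ne) eqxx /=; by case: b.
(* Reversal has no fixed point because the clique has even size. *)
have rev_ne (l : 'I_nclique) : rev_ord l != l.
  by apply/eqP => /(congr1 val) /=; have := ltn_ord l; rewrite /nclique; lia.
have mate_fix t : (mate t == t) =
    if t is inl (j, o) then o == Some (sel j, false) else false.
  case: t => [[j o]|[a l]] /=; first by rewrite (inj_eq inl_inj) xpair_eqE eqxx mo_fix.
  by rewrite (inj_eq inr_inj) xpair_eqE eqxx (negPf (rev_ne l)).
(* Only the exposed vertex has value 0. It is joined to the ports of [sel j] alone, and these have
   value 1. *)
have cross j o a (l : 'I_nclique) : (l == 0 :> nat) && linked j o a.1 ->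
    1 <= y (inl (j, o)) + y (inr (a, l)).
  move=> /= /andP[l0 jo]; have -> : l == port by rewrite -val_eqE.
  case: (o =P Some (sel j, false)) jo => [-> /=|_ _]; last by case: ifP => _; lra.
  by rewrite jsel => /eqP <-; rewrite selI add0r.
have half : (0 : R) < 2^-1 by rewrite invr_gt0.
have [|||||c cs cE] := @fin_stabilizer_of_mate R vertex vadj vadj_sym vadj_irr y mate.
- by move=> [[j o]|[a l]] /=; case: ifP => _ //; apply: ltW.
- move=> [[j o]|[a l]] [[j' o']|[a' l']] /=.
  + case/andP=> /eqP <- oo'; case: eqP => [E|_]; last by case: ifP => _; lra.
    by case: (o' =P Some (sel j, false)) oo' => [->|_ _]; [rewrite E eqxx | rewrite add0r].
  + exact: cross.
  + by move=> /cross; rewrite addrC.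
  + by move=> _; case: ifP => _; case: ifP => _; lra.
- move=> [[j o]|[a l]] /=; first by rewrite moK.
  by rewrite rev_ordK.
- move=> t /eqP; rewrite mate_fix; case: t => [[j o]|[a l]] //= ->; by [].
- move=> t; rewrite mate_fix; case: t => [[j o]|[a l]] /= no; rewrite eqxx eq_sym.
    by rewrite mo_fix.
  by rewrite rev_ne.
exists c => //; rewrite cE.
have sumT (F : vertex -> R) : \sum_t F t =
    \sum_(p : 'I_m * option ('I_n * bool)) F (inl p) +
    \sum_(p : 'I_n * 'I_ncopies * 'I_nclique) F (inr p) by exact: big_sumType.
pose h b : R := if b then 2^-1 else 0.
pose F t := if mate t != t then y t - 2^-1 else 0.
have F_inl j o : F (inl (j, o)) = h (o != Some (sel j, false)).
  by rewrite /F mate_fix /= /h; case: eqP => //= _; lra.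
have F_inr p : F (inr p) = h ((p.2 == port) && (p.1.1 \in I)).
  case: p => a l; rewrite /F mate_fix /= /h; case: ifP => _; lra.
transitivity (\sum_t F t); first by rewrite big_mkcond.
clearbody F; rewrite sumT; congr (_ + _).
  transitivity (\sum_(j < m) \sum_(o | o != Some (sel j, false)) (2^-1 : R)).
    rewrite pair_big_dep [RHS]big_mkcond; apply: eq_bigr => -[j o] _.
    exact: F_inl.
  under eq_bigr do rewrite sumr_const cardC1 card_option card_prod card_bool card_ord /= muln2.
  rewrite sumr_const card_ord -mulrnA -[LHS]mulr_natl -mul2n !natrM; lra.
transitivity (\sum_(a : 'I_n * 'I_ncopies)
    \sum_(l < nclique) h ((l == port) && (a.1 \in I))).
  by rewrite (eq_bigr _ (fun p _ => F_inr p)) pair_bigA.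
transitivity (\sum_(i < n) \sum_(k < ncopies) h (i \in I)).
  rewrite -(pair_bigA _ (fun i k => \sum_(l < nclique) h ((l == port) && (i \in I)))).
  apply: eq_bigr => i _; apply: eq_bigr => k _.
  by rewrite (bigD1 port) //= big1 ?addr0 // => l /negPf ->.
under eq_bigr do rewrite sumr_const card_ord.
by rewrite sumrMnl /h -big_mkcond sumr_const -mulrnA -[LHS]mulr_natl.
Qed.

End Reduction.

(** * From stabilizers to set covers *)

Section Soundness.

Local Open Scope ring_scope.
Variables (R : realType) (X : set_system).
Local Notation m := (n_elements X).
Local Notation n := (n_sets X).
Local Notation ncopies := (ncopies X).
Local Notation nclique := (nclique X).
Local Notation vertex := (vertex X).
Local Notation G := (reduction X).
Variable c : {set 'I_(nvertices G)} -> R.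
Hypothesis c_stab : additive_stabilizer c.
Local Notation cost := (\sum_(f in edges G) c f).
Local Notation wt := (@pair_weight R vertex (@vadj X) (@vadj_sym X) (@vadj_irr X) c).

Definition set_vertex i k : vertex := inr (i, k, port X).

(** The threshold 1/3 balances two cases. If [y] is at least 1/3 on a set clique, a port with value
    at least 1 matched inside it gives an edge of weight at least 1/3. If some vertex is below 1/3,
    all others exceed 2/3, and matching edges between them exceed 1/3. *)
Definition heavy t := [pred u | vadj t u && (3^-1 <= wt t u)].

Definition picked := [set i : 'I_n | [forall k, exists u, heavy (set_vertex i k) u]].

(** Ports are pairwise non-adjacent, so no heavy edge is counted twice. *)
Lemma cost_picked : (#|picked| * ncopies)%:R / 3 <= cost.
Proof.
pose g t := odflt t [pick u in heavy t].
pose U := [set set_vertex p.1 p.2 | p in setX picked [set: 'I_ncopies]].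
have cU : #|U| = (#|picked| * ncopies)%N.
  rewrite card_imset ?cardsX ?cardsT ?card_ord //.
  by move=> [i k] [i' k'] [-> ->].
have UP t : t \in U -> exists2 p, p.1 \in picked & t = set_vertex p.1 p.2.
  by case/imsetP => p; rewrite !inE andbT => pp ->; exists p; rewrite // inE.
rewrite -cU -[leRHS]mul1r; apply: (@card_heavy_le _ _ _ _ _ _ U g 1) => //.
- move=> _ /UP[[i k] /= ip ->]; rewrite /g; case: pickP => [u /andP[]|no] //=.
  by move: ip; rewrite inE => /forallP/(_ k)/existsP[u hu]; have := no u; rewrite [_ \in _]hu.
- move=> t u tu; case tU: (t \in U); case uU: (u \in U) => //.
  move: tu; have [p _ ->] := UP t tU; have [p' _ ->] := UP u uU.
  by rewrite /= andbF.
Qed.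

(** All vertices other than [q] exceed 2/3, so they are matched; off the port this happens inside
    the clique. Outside the four positions in [B] every vertex thus lies on a heavy matching edge,
    and each edge is counted at most twice. *)
Lemma cost_clique (y : vertex -> R) (mate : vertex -> vertex) a q :
  (forall t u, vadj t u -> 1 <= y t + y u) -> involutive mate ->
  (forall t, mate t = t -> y t = 0) ->
  (forall t, mate t != t -> vadj t (mate t) /\ wt t (mate t) = y t + y (mate t) - 1) ->
  y (inr (a, q)) < 3^-1 -> (n * ncopies)%:R / 3 <= cost.
Proof.
move=> yc mateK m0 m1 yq.
(* A port may be matched to an element vertex; the default is then the port, which [B] contains
   anyway. *)
pose loc (t : vertex) := if t is inr (_, l) then l else port X.
pose B := [set port X; q; loc (mate (inr (a, port X))); loc (mate (inr (a, q)))].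
pose U := [set (inr (a, l) : vertex) | l in ~: B].
have y_gt l : l != q -> 1 - y (inr (a, q)) <= y (inr (a, l)).
  move=> lq; rewrite lerBlDr; apply: yc; by rewrite /= eqxx.
have UP t : t \in U -> vadj t (mate t) /\ 3^-1 <= wt t (mate t).
  case/imsetP => l; rewrite !inE !negb_or -!andbA => /and4P[l0 lq lm0 lmq] ->.
  have yl := y_gt l lq.
  have ml : mate (inr (a, l)) != inr (a, l).
    by apply/eqP => /m0 E; move: yl yq; rewrite E; lra.
  have [al ->] := m1 _ ml; split=> //.
  move: al; case E: (mate _) => [[j o]|[a' l']] /=.
    by rewrite -[_ == 0%N]/(val l == val (port X)) val_eqE (negPf l0).
  case/andP=> /eqP aa' ll'; rewrite -aa' in E *.
  have l'q : l' != q.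
    by apply: contra lmq => /eqP <-; rewrite -E mateK.
  have := y_gt l' l'q; lra.
have cB : (#|B| <= 4)%N.
  rewrite /B; do 3![rewrite setUC cardsU1]; rewrite cards1.
  by do 3!case: (_ \notin _).
have cU : (2 * (n * ncopies) <= #|U|)%N.
  rewrite card_imset; last by move=> l l' [].
  rewrite cardsCs setCK card_ord; apply: leq_trans (leq_sub2l _ cB); rewrite /nclique; lia.
have := @card_heavy_le _ _ _ _ _ _ U mate 2 3^-1 c_stab UP.
rewrite -(ler_pM2l (ltr0Sn R 1)) mulrA -natrM => H; apply: le_trans (H _).
  by rewrite ler_wpM2r ?invr_ge0 // ler_nat.
by move=> t u _; case: (t \in U); case: (u \in U).
Qed.

(** If the cost is below the bound, no set clique has a value below 1/3, so all its vertices are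
    matched. The parity arguments then yield an exposed vertex in each element clique. *)
Lemma picked_covers : covers [set: 'I_n] ->
  ~~ covers picked -> (n * ncopies)%:R / 3 <= cost.
Proof.
move=> /coversP cov; apply: contraNT => light.
have [y [mate [y0 yc mateK m0 m1]]] := fin_stabilizer c_stab.
have clique a q : 3^-1 <= y (inr (a, q)).
  by rewrite leNgt; apply: contra light => /(cost_clique yc mateK m0 m1).
have matched a l : mate (inr (a, l)) != inr (a, l).
  by apply/eqP => /m0 E; have := clique a l; rewrite E invr_le0 lern0.
(* Off the port all neighbours lie in the clique. Were the port matched outside, the remaining odd
   number of vertices would be perfectly matched among themselves. *)
have mate_in a l : exists l', mate (inr (a, l)) = inr (a, l').
  have [l0|l0] := eqVneq l (port X); last first.
    have [] := m1 _ (matched a l); case: (mate _) => [[j o]|[a' l']] /=.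
      by rewrite -[_ == 0%N]/(val l == val (port X)) val_eqE (negPf l0).
    by case/andP=> /eqP <- _ _; exists l'.
  rewrite l0; case E: (mate (inr (a, port X))) => [[j o]|[a' l']]; last first.
    by have [] := m1 _ (matched a (port X)); rewrite E /= => /andP[/eqP <- _] _; exists l'.
  pose A := [set (inr (a, l) : vertex) | l in ~: [set port X]].
  have /negP[] : ~~ odd #|A|.
    apply: (@involution_even _ mate) => // t /imsetP[l' l'0 ->]; split=> //.
    have [] := m1 _ (matched a l'); case E': (mate _) => [[j' o']|[a' l'']] /=.
      move: l'0; rewrite !inE -[_ == 0%N]/(val l' == val (port X)) val_eqE.
      by move=> /negPf ->.
    case/andP=> /eqP aa' l'l'' _; apply/imsetP; exists l''; last by rewrite aa'.
    rewrite !inE; apply/eqP => l''0; move: E'; rewrite l''0 -aa' => /(congr1 mate).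
    by rewrite mateK E.
  rewrite card_imset; last by move=> l1 l2 [].
  rewrite cardsC1 card_ord /nclique; lia.
apply/coversP => j.
pose A := [set (inl (j, o) : vertex) | o in [set: option ('I_n * bool)]].
have /existsP[o /eqP jo] : [exists o, mate (inl (j, o)) == inl (j, o)].
  apply: contraT; rewrite negb_exists => /forallP nofix.
  have /negP[] : ~~ odd #|A|.
    apply: (@involution_even _ mate) => // t /imsetP[o _ ->]; split; last exact: nofix.
    have [] := m1 _ (nofix o); case E: (mate _) => [[j' o']|[a l]] /=.
      by case/andP=> /eqP <- _ _; apply/imsetP; exists o'; rewrite ?inE.
    by have [l' E'] := mate_in a l; rewrite -E mateK in E'.
  rewrite card_imset; last by move=> o1 o2 [].
  by rewrite cardsT card_option card_prod card_bool /= muln2 odd_double.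
(* If the exposed vertex stands for a set containing [j], that set is taken; otherwise the vertex is
   joined to all sets, and any set containing [j] will do. *)
have [i ji lji] : exists2 i, j \in member i & linked j o i.
  have [i _ ji] := cov j; case: o {jo} => [[i' b]|]; last by exists i.
  by case ji': (j \in member i'); [exists i' | exists i]; rewrite //= ji' ?eqxx.
exists i => //; rewrite inE; apply/forallP => k; apply/existsP.
have [l E] := mate_in (i, k) (port X).
exists (inr (i, k, l)); have [] := m1 _ (matched (i, k) (port X)).
rewrite E => adjl wl; apply/andP; split=> //; rewrite [wt _ _]wl.
have : 1 <= y (inl (j, o)) + y (set_vertex i k) by apply: yc; rewrite /= lji.
(* The exposed vertex has value 0, so the port has at least 1; its mate has at least 1/3. *)
rewrite (m0 _ jo); have := clique (i, k) l; rewrite /set_vertex; lra.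
Qed.

(** Here [s] and [t] are the sizes of the returned and of the compared cover, and [d] is [m * n].
    The disjunction separates the empty ground set, where the compared cover may be empty. For
    negative [f] the last hypothesis forces [t * N = 0] and hence [s * N <= 0]. *)
Lemma ratio_bound (f s d t N : R) : 0 <= s -> 0 <= d -> 6 * d + 1 <= N ->
  d = 0 /\ 0 <= t \/ 1 <= t -> s * N / 3 <= f * (d + t * N / 2) -> s <= 2 * f * t.
Proof.
move=> s0 d0 Nd dt sN; have N0 : 0 < N by lra.
have t0 : 0 <= t by case: dt => [[]|]; lra.
have dtN : 6 * d <= t * N.
  case: dt => [[-> _]|t1]; [by rewrite mulr0 mulr_ge0 // ltW | by nra].
rewrite -(ler_pM2r N0); have [f0|f0] := leP 0 f; first by nra.
have sN0 : 0 <= s * N by rewrite mulr_ge0 // ltW.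
have tN0 : 0 <= t * N by rewrite mulr_ge0 // ltW.
have : t * N = 0 by nra.
by move=> tN; have : s * N <= 0; nra.
Qed.

Definition selected := if covers picked then picked else [set: 'I_n].

(** Whether or not the picked sets cover, a third of [#|selected| * ncopies] is at most the cost.
    This is compared with the stabilizer built from an arbitrary cover. *)
Lemma selected_approx (f : R) : covers [set: 'I_n] ->
  (forall c' : {set 'I_(nvertices G)} -> R, additive_stabilizer c' ->
    cost <= f * \sum_(e in edges G) c' e) ->
  covers selected /\
  forall I : {set 'I_n}, covers I -> #|selected|%:R <= 2 * f * #|I|%:R.
Proof.
move=> cov cf; have sel_cost : (#|selected| * ncopies)%:R / 3 <= cost.
  rewrite /selected; case: ifPn => [_|/(picked_covers cov)]; first exact: cost_picked.
  by rewrite cardsT card_ord.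
split; first by rewrite /selected; case: ifP.
move=> I covI; have [c' c's c'cost] := cover_stabilizer R covI.
have := cf c' c's; rewrite c'cost => /(le_trans sel_cost).
rewrite natrM [X in _ + X / 2]natrM.
apply: ratio_bound => //; first by rewrite -natrM natr1.
have [m0|m0] := posnP m; first by left; rewrite m0.
right; rewrite ler1n card_gt0; apply/set0Pn.
by have /coversP/(_ (Ordinal m0))[i iI _] := covI; exists i.
Qed.

End Soundness.

(** * The reduction as a program *)

Arguments hd !a /.
Arguments tl !a /.

Ltac ptime_tac := repeat match goal with
  | |- forall _, _ => move=> ?
  | |- ptime (fun x => x) => exact: ptime_id
  | |- ptime hd => exact: ptime_hd0
  | |- ptime tl => exact: ptime_tl0
  | |- ptime (fun _ => ?a) => exact: ptime_const
  | |- ptimeb (fun _ => ?a) => exact: ptimeb_const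
  | H : ptime ?f |- ptime ?f => exact: H
  | H : ptime ?f |- ptime (fun x => ?f x) => exact: H
  | H : ptimeb ?f |- ptimeb (fun x => ?f x) => exact: H
  | |- ptime (fun x => hd (@?f x)) => apply: (@ptime_hd f)
  | |- ptime (fun x => tl (@?f x)) => apply: (@ptime_tl f)
  | |- ptime (fun x => Node (@?f x) (@?g x)) => apply: (@ptime_Node f g)
  | |- ptime (fun x => nth_t (@?f x) (@?g x)) => apply: (@ptime_nth f g)
  | |- ptime (fun x => if _ then _ else _) => apply: ptime_if
  | |- ptime (fun x => enc_bool (@?p x)) => change (ptimeb p)
  | |- ptimeb (fun x => @?f x == @?g x) => apply: (@ptimeb_eq f g)
  | |- ptimeb (fun x => ~~ @?p x) => apply: (@ptimeb_not p)
  | |- ptimeb (fun x => @?p x && @?q x) => apply: (@ptimeb_and p q)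
  | |- ptimeb (fun x => @?p x || @?q x) => apply: (@ptimeb_or p q)
  | |- ptimeb (fun x => @?p x ==> @?q x) => apply: (@ptimeb_imply p q)
  | |- ptimeb (fun x => if _ then _ else _) => apply: ptimeb_if
  end.

(** * Comparing a binary rational with one third *)

Definition bits : seq bool -> btree := enc_seq enc_bool.
Definition bits_val : seq bool -> nat := foldr (fun (b : bool) v => b + v.*2) 0.

Lemma bits_val_pos p : bits_val (bits_of_pos p) = nat_of_pos p.
Proof. by elim: p => //= p ->; rewrite NatTrec.doubleE ?add0n ?add1n. Qed.

Lemma bits_val_nat k : bits_val (bits_of_nat k) = k.
Proof.
rewrite /bits_of_nat -[RHS]bin_of_natK; case: (bin_of_nat k) => //= p.
exact: bits_val_pos.
Qed.

Lemma bits_val_lt s : bits_val s < 2 ^ size s.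
Proof. by elim: s => //= b s; rewrite expnS; case: b; lia. Qed.

(* One step of the comparison of 3a with b, least significant bits first.  The
   state is ((a, b), ((previous bit of a, carry), flag)): 3a is computed as
   a + 2a, and the flag tells whether 3a >= b for the bits already read. *)
Definition third_step (st : btree) : btree :=
  let p := hd (hd (hd st)) != Leaf in
  let q := hd (tl (hd st)) != Leaf in
  let r := hd (hd (tl st)) != Leaf in
  let c := tl (hd (tl st)) != Leaf in
  let f := tl (tl st) != Leaf in
  let d := if p then (if r then c else ~~ c) else (if r then ~~ c else c) in
  Node (Node (tl (hd (hd st))) (tl (tl (hd st))))
    (Node (Node (enc_bool p) (enc_bool (if p then r || c else r && c)))
      (enc_bool (if d then (if q then f else true) else (if q then false else f)))).

Definition third_state (a b : seq bool) (r c f : bool) :=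
  Node (Node (bits a) (bits b)) (Node (Node (enc_bool r) (enc_bool c)) (enc_bool f)).

(** The bit [r] is the pending low bit of twice [a], so what remains to be compared with [b] is
    [3a + r + c], with [f] deciding ties. The size hypotheses say that there are enough rounds to
    exhaust both numbers. *)
Lemma third_steps (s : seq btree) a b (r c f : bool) :
  3 * bits_val a + r + c < 2 ^ size s -> bits_val b < 2 ^ size s ->
  tl (tl (foldl (fun st _ => third_step st) (third_state a b r c f) s)) =
  enc_bool ((bits_val b < 3 * bits_val a + r + c) ||
            (bits_val b == 3 * bits_val a + r + c) && f).
Proof.
have eb0 x : (enc_bool x != Leaf) = x by case: x.
elim: s a b r c f => [|e s IH] a b r c f.
  rewrite expn0 !ltnS !leqn0 => /eqP -> /eqP ->; by rewrite ltnn eqxx.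
rewrite [size _]/= expnS /=.
have -> : third_step (third_state a b r c f) =
    let p := head false a in let q := head false b in
    let d := if p then (if r then c else ~~ c) else (if r then ~~ c else c) in
    third_state (behead a) (behead b) p (if p then r || c else r && c)
      (if d then (if q then f else true) else (if q then false else f)).
  by rewrite /third_step /third_state /=; case: a => [|p a]; case: b => [|q b] /=;
    rewrite ?eqxx /= !eb0.
have va : bits_val a = head false a + (bits_val (behead a)).*2 by case: a.
have vb : bits_val b = head false b + (bits_val (behead b)).*2 by case: b.
move: va vb; move: (head _ _) (head _ _) (behead a) (behead b) => p q a' b' -> -> ha hb.
rewrite IH; last by move: ha hb; case: q; lia.
  by congr enc_bool; move: ha hb; case: p; case: q; case: r; case: c => /=; case: f; lia.
by move: ha hb; case: p; case: r; case: c => /=; lia.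
Qed.

(** The folded list serves only as a round counter: three times a number needs at most two extra
    bits. The initial flag makes equality count as success. The sign is not read, since the test is
    meant for nonnegative weights. *)
Definition third (e : btree) : bool :=
  let a := tl (hd e) in let b := tl (tl e) in
  tl (tl (foldl (fun st _ => third_step st)
    (Node (Node a b) (Node (Node Leaf Leaf) (enc_bool true)))
    (lst (tree ([:: Leaf; Leaf] ++ (lst a ++ lst b)))))) != Leaf.

Lemma size_bits s : size (lst (bits s)) = size s.
Proof. by elim: s => //= b s ->. Qed.

Lemma thirdE (r : rat) : third (enc_rat r) = (`|denq r| <= 3 * `|numq r|)%N.
Proof.
set a := bits_of_nat `|numq r|; set b := bits_of_nat `|denq r|.
rewrite -[third _]/(tl (tl (foldl (fun st _ => third_step st)
  (third_state a b false false true)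
  (lst (tree ([:: Leaf; Leaf] ++ (lst (bits a) ++ lst (bits b))))))) != Leaf).
have := bits_val_lt a; have := bits_val_lt b.
have sz : size (lst (tree ([:: Leaf; Leaf] ++ (lst (bits a) ++ lst (bits b))))) =
    (size a + size b).+2 by rewrite treeK /= size_cat !size_bits.
have a1 : 0 < 2 ^ size a by rewrite expn_gt0.
have b1 : 0 < 2 ^ size b by rewrite expn_gt0.
move=> ltb lta; rewrite third_steps ?sz ?expnS ?expnD; [|nia|nia].
rewrite !addn0 andbT orbC -leq_eqVlt !bits_val_nat.
by case: (_ <= _)%N.
Qed.

Lemma ptime_step f : ptime f -> ptime (fun x => third_step (f x)).
Proof. by move=> pf; rewrite /third_step /=; ptime_tac. Qed.

Lemma tsize_hd_tl a : tsize (hd a) + tsize (tl a) <= (tsize a).+1.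
Proof. by case: a => //= a b; lia. Qed.

Lemma tsize_third_step st : tsize (third_step st) <= tsize st + 30.
Proof.
have sz p q r c f : tsize (Node (Node p q) (Node (Node (enc_bool r) (enc_bool c))
    (enc_bool f))) <= tsize p + tsize q + 13.
  have := tsize_enc_bool r; have := tsize_enc_bool c; have := tsize_enc_bool f.
  by rewrite /=; lia.
apply: leq_trans (sz _ _ _ _ _) _.
have := tsize_tl (hd (hd st)); have := tsize_tl (tl (hd st)).
have := tsize_hd_tl (hd st); have := tsize_hd st; lia.
Qed.

Lemma ptimeb_third f : ptime f -> ptimeb (fun x => third (f x)).
Proof.
move=> pf; rewrite /third; apply/ptimeb_not/ptimeb_eq; last exact: ptime_Leaf.
apply/ptime_tl/ptime_tl.
apply: (@ptime_foldl_add (fun _ st _ => third_step st) _ _ (fun=> 30)).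
- by apply: ptime_step; ptime_tac.
- apply: ptime_cat; first exact: ptime_const.
  apply: ptime_cat.
    by apply: (@eq_ptime (fun x => tl (hd (f x)))) => [x|]; rewrite ?lstK //; ptime_tac.
  by apply: (@eq_ptime (fun x => tl (tl (f x)))) => [x|]; rewrite ?lstK //; ptime_tac.
- by ptime_tac.
- exact: polyb_const.
- by move=> x e a _; apply: tsize_third_step.
Qed.

Lemma ptime_flatmap (F : btree -> btree -> seq btree) s :
  ptime (fun z => tree (F (hd z) (tl z))) -> ptime (fun x => tree (s x)) ->
  ptime (fun x => tree (flatten [seq F e x | e <- s x])).
Proof.
move=> pF ps; apply: (@ptime_flatten (fun x => [seq F e x | e <- s x])).
apply: (@eq_ptime (fun x => tree [seq tree (F e x) | e <- s x])).
  by move=> x; rewrite -map_comp.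
exact: (@ptime_map (fun e x => tree (F e x))).
Qed.

(** * Index ranges, vertex labels and the adjacency matrix *)

Definition iota_t (s : seq btree) := map un (iota 0 (size s)).
Definition elems_t (x : btree) := iota_t (lst (hd x)).
Definition sets_t (x : btree) := iota_t (lst (tl x)).
(** Only lengths matter: flattening one copy of a list per entry of another multiplies lengths,
    which gives [6 * (m * n) + 1]. The range [clique_t] is obtained in the same way. *)
Definition copies_t (x : btree) := iota_t (Leaf ::
  flatten [seq flatten [seq lst (tl x) | _ <- lst (hd x)] | _ <- nseq 6 Leaf]).
Definition clique_t (x : btree) := iota_t
  (flatten [seq Leaf :: Leaf :: flatten [seq copies_t x | _ <- lst (tl x)]
    | _ <- nseq 2 Leaf]).

Lemma ptime_lst f : ptime f -> ptime (fun x => tree (lst (f x))).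
Proof. by apply: eq_ptime => x; rewrite lstK. Qed.

Lemma ptime_elems f : ptime f -> ptime (fun x => tree (elems_t (f x))).
Proof. by move=> pf; apply/ptime_iota/ptime_lst/ptime_hd. Qed.

Lemma ptime_sets f : ptime f -> ptime (fun x => tree (sets_t (f x))).
Proof. by move=> pf; apply/ptime_iota/ptime_lst/ptime_tl. Qed.

Lemma ptime_copies f : ptime f -> ptime (fun x => tree (copies_t (f x))).
Proof.
move=> pf; apply: ptime_iota; apply: ptime_Node; first exact: ptime_Leaf.
apply: (@ptime_flatmap
  (fun _ x => flatten [seq lst (tl (f x)) | _ <- lst (hd (f x))])
  (fun=> nseq 6 Leaf)); last exact: ptime_const.
have pf' : ptime (fun z => f (tl z)) by apply: ptime_comp pf ptime_tl0.
apply: (@ptime_flatmap (fun _ z => lst (tl (f (tl z))))).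
  apply: ptime_lst; apply: ptime_tl; apply: ptime_comp pf' ptime_tl0.
by apply: ptime_lst; ptime_tac.
Qed.

Lemma ptime_clique f : ptime f -> ptime (fun x => tree (clique_t (f x))).
Proof.
move=> pf; apply: ptime_iota.
apply: (@ptime_flatmap
  (fun _ x => Leaf :: Leaf :: flatten [seq copies_t (f x) | _ <- lst (tl (f x))])
  (fun=> nseq 2 Leaf)); last exact: ptime_const.
have pf' : ptime (fun z => f (tl z)) by apply: ptime_comp pf ptime_tl0.
rewrite /=; do 2![apply: ptime_Node; first exact: ptime_Leaf].
apply: (@ptime_flatmap (fun _ z => copies_t (f (tl z)))).
  apply: ptime_copies; apply: ptime_comp pf' ptime_tl0.
by apply: ptime_lst; ptime_tac.
Qed.

Definition bit_t x i j := nth_t (nth_t (tl x) i) j != Leaf.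

(* A label is ((clique), (position in the clique, joined to)).  For an element
   vertex the last component is the set to whose copies the vertex is joined, or
   Leaf if it is joined to the copies of all sets. *)
Definition root_label j := Node (Node Leaf j) (Node Leaf Leaf).
Definition elem_label x j i b := Node (Node Leaf j)
  (Node (Node i b) (if bit_t x i j then Node Leaf i else Leaf)).
Definition set_label i k l := Node (Node (Node Leaf i) k) (Node l Leaf).

(** The loops follow the canonical enumeration of [vertex], with the root before the set vertices
    and [true] before [false], because the encoded matrix depends on this order. *)
Definition elem_verts x := flatten [seq root_label j ::
  flatten [seq [:: elem_label x j i (enc_bool true); elem_label x j i (enc_bool false)]
  | i <- sets_t x] | j <- elems_t x].
Definition set_verts x := flatten [seq flatten
  [seq [seq set_label i k l | l <- clique_t x] | k <- copies_t x] | i <- sets_t x].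
Definition verts_t x := elem_verts x ++ set_verts x.

Lemma ptime_verts f : ptime f -> ptime (fun x => tree (verts_t (f x))).
Proof.
apply: (@ptime_comp (fun x => tree (verts_t x))); apply: ptime_cat.
  apply: (@ptime_flatmap (fun j x => root_label j :: flatten
    [seq [:: elem_label x j i (enc_bool true); elem_label x j i (enc_bool false)]
    | i <- sets_t x])).
    apply: ptime_Node; first by rewrite /root_label; ptime_tac.
    apply: (@ptime_flatmap (fun i z => [:: elem_label (tl z) (hd z) i (enc_bool true);
      elem_label (tl z) (hd z) i (enc_bool false)])).
      by rewrite /elem_label /bit_t /=; ptime_tac.
    exact: (ptime_sets ptime_tl0).
  exact: (ptime_elems ptime_id).
apply: (@ptime_flatmap (fun i x => flatten
  [seq [seq set_label i k l | l <- clique_t x] | k <- copies_t x])).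
  apply: (@ptime_flatmap (fun k z => [seq set_label (hd z) k l | l <- clique_t (tl z)])).
    apply: (@ptime_map (fun l w => set_label (hd (tl w)) (hd w) l)).
      by rewrite /set_label; ptime_tac.
    exact: (ptime_clique (ptime_tl ptime_tl0)).
  exact: (ptime_copies ptime_tl0).
exact: (ptime_sets ptime_id).
Qed.

(** Sets occur as [Node Leaf i] because the numeral 0 is [Leaf]: the wrapper separates index 0 from
    the marker for an element clique or for being joined to all sets. The bare [Leaf] in [hd (tl v)]
    is position 0, the port. *)
Definition cross_t u v := [&& hd (hd u) == Leaf, hd (hd v) != Leaf, hd (tl v) == Leaf
  & (tl (tl u) == Leaf) || (tl (tl u) == hd (hd v))].
Definition adj_t u v :=
  if hd u == hd v then u != v else cross_t u v || cross_t v u.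

Lemma ptimeb_adj f g : ptime f -> ptime g -> ptimeb (fun x => adj_t (f x) (g x)).
Proof. by move=> pf pg; rewrite /adj_t /cross_t; ptime_tac. Qed.

Definition graph_t x := tree
  [seq tree [seq enc_bool (adj_t u v) | v <- verts_t x] | u <- verts_t x].

Lemma ptime_graph : ptime graph_t.
Proof.
apply: (@ptime_map (fun u x => tree [seq enc_bool (adj_t u v) | v <- verts_t x])).
  apply: (@ptime_map (fun v z => enc_bool (adj_t (hd z) v))).
    exact: (ptimeb_adj (ptime_hd ptime_tl0) ptime_hd0).
  exact: (ptime_verts ptime_tl0).
exact: (ptime_verts ptime_id).
Qed.

(* Here z is the pair of the instance and of the stabilizer. *)
Definition heavy_t z p q :=
  adj_t (nth_t (tree (verts_t (hd z))) p) (nth_t (tree (verts_t (hd z))) q)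
  && third (nth_t (nth_t (tl z) p) q).
Definition port_t i u := (hd (hd u) == Node Leaf i) && (hd (tl u) == Leaf).
Definition picked_t z i := all (fun p =>
  port_t i (nth_t (tree (verts_t (hd z))) p) ==>
  has (fun q => heavy_t z p q) (iota_t (verts_t (hd z)))) (iota_t (verts_t (hd z))).
Definition covers_t z := all (fun j =>
  has (fun i => bit_t (hd z) i j && picked_t z i) (sets_t (hd z))) (elems_t (hd z)).
Definition select_t z := tree
  [seq enc_bool (if covers_t z then picked_t z i else true) | i <- sets_t (hd z)].

Lemma ptimeb_heavy f g h : ptime f -> ptime g -> ptime h ->
  ptimeb (fun x => heavy_t (f x) (g x) (h x)).
Proof.
move=> pf pg ph; apply: ptimeb_and.
  by apply: ptimeb_adj; apply: ptime_nth => //; apply: ptime_verts; apply: ptime_hd.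
by apply: ptimeb_third; ptime_tac.
Qed.

Lemma ptimeb_picked f g : ptime f -> ptime g -> ptimeb (fun x => picked_t (f x) (g x)).
Proof.
move=> pf pg; rewrite /picked_t.
have p2 F : ptime F -> ptime (fun z => F (tl z)) by move=> pF; apply: ptime_comp pF ptime_tl0.
have pv F : ptime F -> ptime (fun x => tree (verts_t (hd (F x)))).
  by move=> pF; apply/ptime_verts/ptime_hd.
apply: (@ptimeb_all (fun p x => port_t (g x) (nth_t (tree (verts_t (hd (f x)))) p) ==>
  has (fun q => heavy_t (f x) p q) (iota_t (verts_t (hd (f x))))));
  last exact/ptime_iota/pv.
have pf2 := p2 _ pf; have pg2 := p2 _ pg.
apply: ptimeb_imply.
  by rewrite /port_t; have := pv _ pf2; move=> pv2; ptime_tac.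
apply: (@ptimeb_has (fun q z => heavy_t (f (tl z)) (hd z) q)); last exact/ptime_iota/pv.
have pf3 := p2 _ pf2.
by apply: (@ptimeb_heavy (fun x => f (tl (tl x))) (fun x => hd (tl x)) hd); ptime_tac.
Qed.

Lemma ptimeb_covers f : ptime f -> ptimeb (fun x => covers_t (f x)).
Proof.
apply: (@ptime_comp (fun z => enc_bool (covers_t z))).
apply: (@ptimeb_all
  (fun j z => has (fun i => bit_t (hd z) i j && picked_t z i) (sets_t (hd z)))
  (fun z => elems_t (hd z))).
  apply: (@ptimeb_has (fun i w => bit_t (hd (tl w)) i (hd w) && picked_t (tl w) i)
    (fun w => sets_t (hd (tl w)))).
    apply: ptimeb_and; first by rewrite /bit_t; ptime_tac.
    exact: (ptimeb_picked (ptime_tl ptime_tl0) ptime_hd0).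
  exact: (ptime_sets (ptime_hd ptime_tl0)).
exact: (ptime_elems ptime_hd0).
Qed.

Lemma ptime_select : ptime select_t.
Proof.
apply: (@ptime_map (fun i z => enc_bool (if covers_t z then picked_t z i else true)));
  last exact: (ptime_sets ptime_hd0).
apply: (@ptimeb_if (fun w => covers_t (tl w)) (fun w => picked_t (tl w) (hd w)) (fun=> true));
  last exact: ptimeb_const.
  exact: (ptimeb_covers ptime_tl0).
exact: (ptimeb_picked ptime_tl0 ptime_hd0).
Qed.

(** * Correctness of the program *)

Lemma enc_seqE T (enc : T -> btree) s : enc_seq enc s = tree (map enc s).
Proof. by elim: s => //= a s ->. Qed.

Lemma enc_matrixE T (enc : T -> btree) m n (a : 'I_m -> 'I_n -> T) :
  enc_matrix enc a = tree [seq tree [seq enc (a i j) | j <- enum 'I_n] | i <- enum 'I_m].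
Proof.
rewrite /enc_matrix /enc_vector enc_seqE map_id; congr tree; apply: eq_map => i.
by rewrite enc_seqE -map_comp.
Qed.

Lemma nth_map_ord n (F : 'I_n -> btree) (i : 'I_n) :
  nth Leaf [seq F j | j <- enum 'I_n] i = F i.
Proof. by rewrite (nth_map i) ?size_enum_ord // nth_ord_enum. Qed.

Lemma iota_tE s n : size s = n -> iota_t s = [seq un i | i : 'I_n <- enum 'I_n].
Proof. by move=> <-; rewrite /iota_t -val_enum_ord -map_comp. Qed.

Lemma un_eqE i j : (un i == un j) = (i == j).
Proof. exact: inj_eq un_inj _ _. Qed.

Lemma Node_eqE a b a' b' : (Node a b == Node a' b') = (a == a') && (b == b').
Proof. by []. Qed.

Lemma map_enum_sum (A B : finType) T (f : A + B -> T) :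
  [seq f p | p <- enum {: A + B}] =
  [seq f (inl a) | a <- enum A] ++ [seq f (inr b) | b <- enum B].
Proof. by rewrite !enumT [in LHS]unlock map_cat -!map_comp. Qed.

Lemma map_enum_prod (A B : finType) T (f : A * B -> T) :
  [seq f p | p <- enum {: A * B}] = flatten [seq [seq f (a, b) | b <- enum B] | a <- enum A].
Proof.
rewrite [X in map f X]enumT [in LHS]unlock map_flatten -map_comp; congr flatten.
by apply: eq_map => a; rewrite /= -map_comp.
Qed.

Lemma map_enum_option (A : finType) T (f : option A -> T) :
  [seq f o | o <- enum {: option A}] = f None :: [seq f (Some a) | a <- enum A].
Proof. by rewrite !enumT [in LHS]unlock /= -map_comp. Qed.

Lemma map_enum_bool T (f : bool -> T) :
  [seq f b | b <- enum {: bool}] = [:: f true; f false].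
Proof. by rewrite enumT unlock. Qed.

Lemma size_flatten_const T (U : Type) (s : seq T) (r : seq U) :
  size (flatten [seq r | _ <- s]) = size s * size r.
Proof. by elim: s => //= e s IH; rewrite size_cat IH. Qed.

Lemma map_enum_val (T : finType) : [seq enum_val i | i <- enum 'I_#|T|] = enum T.
Proof.
case E: (enum T) => [|x0 s].
  by apply: size0nil; rewrite size_map size_enum_ord cardE E.
rewrite -E; apply: (@eq_from_nth _ x0); rewrite size_map size_enum_ord; first by rewrite cardE.
move=> i lti; rewrite (nth_map (Ordinal lti)) ?size_enum_ord //.
by rewrite (nth_ord_enum _ (Ordinal lti)) (enum_val_nth x0).
Qed.

Section Correctness.

Variables (R : realType) (X : set_system).
Local Notation m := (n_elements X).
Local Notation n := (n_sets X).
Local Notation G := (reduction X).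

Let x := encode (m := SetCover R) X.

Let hdx : lst (hd x) = nseq m Leaf.
Proof.
rewrite /x /= enc_seqE treeK -[in RHS](size_enum_ord m).
by elim: (enum 'I_m) => //= j s ->.
Qed.

Let tlx : lst (tl x) =
  [seq tree [seq enc_bool (j \in member i) | j <- enum 'I_m] | i <- enum 'I_n].
Proof. by rewrite /x [tl _]/= enc_matrixE treeK. Qed.

Let elems_tE : elems_t x = [seq un j | j : 'I_m <- enum 'I_m].
Proof. by apply: iota_tE; rewrite hdx size_nseq. Qed.

Let size_rows : size (lst (tl x)) = n.
Proof. by rewrite tlx size_map size_enum_ord. Qed.

Let sets_tE : sets_t x = [seq un i | i : 'I_n <- enum 'I_n].
Proof. exact: iota_tE. Qed.

Let copies_tE : copies_t x = [seq un k | k : 'I_(ncopies X) <- enum 'I_(ncopies X)].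
Proof.
apply: iota_tE; set s := flatten _; rewrite -[size _]/(size s).+1 /s; congr _.+1.
by rewrite !size_flatten_const size_rows hdx !size_nseq.
Qed.

Let clique_tE : clique_t x = [seq un l | l : 'I_(nclique X) <- enum 'I_(nclique X)].
Proof.
apply: iota_tE; rewrite size_flatten_const size_nseq /= size_flatten_const size_rows.
by rewrite copies_tE size_map size_enum_ord.
Qed.

Let bit_tE (i : 'I_n) (j : 'I_m) : bit_t x (un i) (un j) = (j \in member i).
Proof.
rewrite /bit_t -[tl x]lstK tlx nth_tE nth_map_ord nth_tE nth_map_ord.
by case: (_ \in _).
Qed.

Definition label (v : vertex X) : btree :=
  match v with
  | inl (j, None) => root_label (un j)
  | inl (j, Some (i, b)) => elem_label x (un j) (un i) (enc_bool b)
  | inr (i, k, l) => set_label (un i) (un k) (un l)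
  end.

Lemma verts_tE : verts_t x = [seq label v | v <- enum (vertex X)].
Proof.
rewrite map_enum_sum /verts_t; congr (_ ++ _).
  rewrite map_enum_prod /elem_verts elems_tE -map_comp; congr flatten.
  apply: eq_map => j; rewrite map_enum_option; congr cons.
  rewrite map_enum_prod sets_tE -map_comp; congr flatten.
  by apply: eq_map => i; rewrite map_enum_bool.
rewrite !map_enum_prod /set_verts sets_tE copies_tE clique_tE -map_comp.
have -> T (ss : seq (seq (seq T))) : flatten (flatten ss) = flatten (map flatten ss).
  by elim: ss => //= s ss <-; rewrite flatten_cat.
rewrite -map_comp; congr flatten; apply: eq_map => i /=; congr flatten.
rewrite -map_comp; apply: eq_map => k /=.
by rewrite -map_comp.
Qed.

(** Within a clique labels differ exactly when positions do, since the last component of an element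
    label is determined by the others. Across cliques only pairs of an element and a set vertex pass
    the test. *)
Lemma adj_tE u v : adj_t (label u) (label v) = vadj u v.
Proof.
have link j o (a : 'I_n * 'I_(ncopies X)) (l : 'I_(nclique X)) :
    cross_t (label (inl (j, o))) (label (inr (a, l))) = (l == 0 :> nat) && linked j o a.1.
  case: a => i k; rewrite /cross_t /= -[Leaf]/(un 0) un_eqE.
  by case: o => [[i' b]|] //=; rewrite bit_tE; case: (_ \in _) => //=;
    rewrite Node_eqE un_eqE.
have hd_inl j o : hd (label (inl (j, o))) = Node Leaf (un j) by case: o => [[]|].
have hd_inr a l : hd (label (inr (a, l))) = Node (Node Leaf (un a.1)) (un a.2) by case: a.
have no_cross w j o : cross_t w (label (inl (j, o))) = false.
  by rewrite /cross_t hd_inl /= andbF.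
have no_cross' w a l : cross_t (label (inr (a, l))) w = false.
  by rewrite /cross_t hd_inr.
rewrite /adj_t; case: u v => [[j o]|[a l]] [[j' o']|[a' l']].
- rewrite !hd_inl !no_cross Node_eqE un_eqE /= val_eqE; case: eqP => //= <-.
  congr negb; case: o o' => [[i b]|] [[i' b']|] //=;
    rewrite /elem_label /root_label !Node_eqE ?andbF //= ?eqxx //.
  rewrite un_eqE val_eqE (inj_eq Some_inj) xpair_eqE; case: (i =P i') => [->|_] //=.
  by rewrite eqxx andbT; case: b; case: b'.
- by rewrite hd_inl hd_inr no_cross' orbF link.
- by rewrite hd_inl hd_inr no_cross' link.
- case: a a' => [i k] [i' k']; rewrite !hd_inr !no_cross' !Node_eqE !un_eqE /= !val_eqE.
  by rewrite xpair_eqE eqxx andbT; case: (_ && _).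
Qed.

Lemma graph_tE : graph_t x = encode (m := MFASP R) G.
Proof.
have E T (f : vertex X -> T) : [seq f v | v <- enum (vertex X)] =
    [seq f (enum_val v) | v <- enum 'I_#|vertex X|].
  by rewrite -map_enum_val -map_comp.
rewrite /graph_t verts_tE [RHS]enc_matrixE -map_comp E; congr tree.
apply: eq_map => v /=; rewrite -map_comp E; congr tree.
by apply: eq_map => u; rewrite /= adj_tE.
Qed.

Let rat_third (r : rat) : (0 <= ratr r :> R)%R ->
  third (enc_rat r) = (3^-1 <= ratr r :> R)%R.
Proof.
rewrite thirdE ler0q => r0; have d0 : (0 < (denq r)%:~R :> R)%R by rewrite ltr0z denq_gt0.
rewrite /ratr ler_pdivlMr // mulrC ler_pdivrMr ?ltr0n // -lez_nat PoszM.
rewrite !gez0_abs ?numq_ge0 ?denq_ge0 //.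
by rewrite -(ler_int R) intrM mulrC.
Qed.

Section Select.

Variables (c : {set 'I_(nvertices G)} -> R) (q : {set 'I_(nvertices G)} -> rat).
Hypotheses (c_stab : additive_stabilizer c) (cq : forall e, c e = ratr (q e)).

Let z := Node x (enc_matrix enc_rat (fun u v => q [set u; v])).

Let nth_verts (v : 'I_#|vertex X|) :
  nth_t (tree (verts_t (hd z))) (un v) = label (enum_val v).
Proof. by rewrite nth_tE verts_tE -map_enum_val -map_comp nth_map_ord. Qed.

Let verts_iota : iota_t (verts_t (hd z)) =
  [seq un v | v : 'I_#|vertex X| <- enum 'I_#|vertex X|].
Proof. by apply: iota_tE; rewrite verts_tE size_map cardE. Qed.

Let heavy_tE (u v : 'I_#|vertex X|) :
  heavy_t z (un u) (un v) = heavy c (enum_val u) (enum_val v).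
Proof.
have entry : nth_t (nth_t (tl z) (un u)) (un v) = enc_rat (q [set u; v]).
  by rewrite [tl z]enc_matrixE nth_tE nth_map_ord nth_tE nth_map_ord.
(* Off the edges the matrix entries are arbitrary, and adjacency rejects them; on an edge the weight
   is nonnegative, as the test against one third requires. *)
rewrite /heavy_t !nth_verts adj_tE entry /=; case uv: (vadj _ _) => //=.
have := pair_weight_ge0 c_stab uv; rewrite /pair_weight !enum_valK cq.
exact: rat_third.
Qed.

Let port_tE (i : 'I_n) t : port_t (un i) (label t) = [exists k, t == set_vertex i k].
Proof.
apply/idP/existsP => [|[k /eqP ->]]; last by rewrite /port_t /= Node_eqE !eqxx.
case: t => [[j [[i' b]|]]|[[i' k] l]] //=.
rewrite /port_t /= Node_eqE /= -[Leaf]/(un 0) !un_eqE => /andP[/eqP/val_inj -> /eqP l0].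
by exists k; rewrite /set_vertex; apply/eqP; congr (inr (_, _, _)); apply: val_inj.
Qed.

Let picked_tE (i : 'I_n) : picked_t z (un i) = (i \in picked c).
Proof.
rewrite /picked_t verts_iota all_map inE; apply/allP/forallP => [H k|H v _ /=].
  have := H (enum_rank (set_vertex i k)); rewrite mem_enum => /(_ isT) /=.
  rewrite nth_verts enum_rankK port_tE.
  have -> /= : [exists k', set_vertex i k == set_vertex i k'].
    by apply/existsP; exists k.
  rewrite has_map => /hasP[u _ /=]; rewrite heavy_tE enum_rankK => hu.
  by apply/existsP; exists (enum_val u).
rewrite nth_verts port_tE; apply/implyP => /existsP[k /eqP vk].
have /existsP[u hu] := H k; rewrite has_map; apply/hasP; exists (enum_rank u).
  by rewrite mem_enum.
by rewrite /= heavy_tE enum_rankK vk.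
Qed.

Lemma select_tE : select_t z = enc_vector enc_bool (fun i => i \in selected c).
Proof.
have E : covers_t z = covers (picked c).
  rewrite /covers_t elems_tE sets_tE all_map; apply/allP/coversP => [H j|H j _ /=].
    have := H j; rewrite mem_enum /= has_map => /(_ isT)/hasP[i _ /=].
    by rewrite bit_tE picked_tE => /andP[ji pi]; exists i.
  have [i pi ji] := H j; rewrite has_map; apply/hasP; exists i; first by rewrite mem_enum.
  by rewrite /= bit_tE picked_tE ji.
rewrite /select_t /enc_vector enc_seqE sets_tE -!map_comp; congr tree.
apply: eq_map => i /=; rewrite E /selected picked_tE.
by case: (covers _); rewrite ?inE.
Qed.

End Select.

End Correctness.

Local Open Scope ring_scope.

Theorem theorem7 (R : realType) (f : R) :
  polytime_approximable (MFASP R) f -> polytime_approximable (SetCover R) (2 * f).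
Proof.
move=> [c [p Hc]].
have [c' [p' H]] := turing_reduction c p ptime_graph ptime_select.
exists c', p' => X; have [t [out [Hr ht Ha]]] := Hc (reduction X).
rewrite -(graph_tE R) in Hr ht; have [t' Hr' ht'] := H _ _ _ Hr ht.
exists t', (select_t (Node (encode (m := SetCover R) X) out)); split=> //.
move=> [I /eqP covI].
(* The guarantee of the algorithm applies only if a stabilizer exists; a set cover provides one. *)
have [c0 c0s _] := cover_stabilizer R covI.
have [s [[q [sq outE]] s_stab s_opt]] := Ha (ex_intro _ c0 c0s).
have covT : covers [set: 'I_(n_sets X)].
  by apply/coversP => j; have /coversP/(_ j)[i _ ji] := covI; exists i.
have [cov_sel sel_opt] := selected_approx s_stab covT s_opt.
exists (selected s); split; first by rewrite outE; apply: select_tE.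
- exact/eqP.
- by move=> I' /eqP; apply: sel_opt.
Qed.
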